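(* Let $v(\cdot,(u_0,W_0))=(u(\cdot,u_0),W(\cdot,W_0))$ be a couple of strong Markov processes on Polish spaces $(E,d_E)$ and $(F,d_F)$, with time set $I=\mathbb R^+$ or $I=T\mathbb N=\{kT:k\in\mathbb N\}$, where $T>0$, and let $\mathcal H:E\to\mathbb R^+$. Assume that for any $(u_0^1,W_0^1),(u_0^2,W_0^2)\in E\times F$ there exists a coupling $V=(v_1,v_2)$, $v_i=(u_i,W_i)$, of the laws of $(u(\cdot,u_0^1),W(\cdot,W_0^1))$ and $(u(\cdot,u_0^2),W(\cdot,W_0^2))$, and a random integer-valued process $l_0:\mathbb N\to\mathbb N\cup\{\infty\}$, such that $V$ is $l_0$-Markov and, with $\mathcal H_k=\mathcal H(u_1(kT))+\mathcal H(u_2(kT))$ and constants that do not depend on the initial data, the following five conditions hold. (i) There is $d_0>0$ such that: $l_0(k+1)=l$ implies $l_0(k)=l$ for any $l\le k$; $l_0(k)\in\{0,1,\dots,k\}\cup\{\infty\}$; $l_0(k)$ depends only on $v_1|_{[0,kT]}$ and $v_2|_{[0,kT]}$; and $l_0(k)=k$ implies $\mathcal H_k\le d_0$. (ii) There exist $c_0>0$ and $q>0$ such that for any $l\le k$ and any $t\in[lT,kT]\cap I$, $$\mathbb P\bigl(d_E(u_1(t),u_2(t))>c_0(t-lT)^{-q}\ \text{and}\ l_0(k)\le l\bigr)\le c_0(t-lT)^{-q}.$$ (iii) There exist $(p_k)_{k\in\mathbb N}$, $c_1>0$ and $q_0>1+q$ such that $\mathbb P(l_0(k+1)=l\mid l_0(k)=l)\ge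 p_{k-l}$ for any $l\le k$, and $1-p_k\le c_1((k+1)T)^{-q_0}$, $p_k>0$ for any $k\in\mathbb N$. (iv) There exist $p_{-1}>0$ and $R_0>0$ such that $\mathbb P(l_0(k+1)=k+1\mid l_0(k)=\infty,\ \mathcal H_k\le R_0)\ge p_{-1}$. (v) There exist constants $\alpha>0$, $K_1$ and $K'$ such that for any initial data $v_0=(u_0,W_0)$ and any stopping time $\tau'$ with values in $\{kT:k\in\mathbb N\}\cup\{\infty\}$, $$\mathbb E\,\mathcal H(u(t,u_0))\le e^{-\alpha t}\mathcal H(u_0)+\tfrac{K_1}{2},\quad t\ge0,$$ $$\mathbb E\bigl(\mathcal H(u(\tau',u_0))1_{\tau'<\infty}\bigr)\le K'\bigl(\mathcal H(u_0)+\mathbb E(\tau'1_{\tau'<\infty})\bigr).$$ Assume moreover that $R_0>4K_1$ and $R_0\ge d_0$. Then there exists $c_4>0$ such that, for any $\varphi\in Lip_b(E)$, any $u_0^1,u_0^2\in E$ and any $t\in I$, $$\bigl|\mathbb E\varphi(u(t,u_0^1))-\mathbb E\varphi(u(t,u_0^2))\bigr|\le c_4(1+t)^{-q}\|\varphi\|_L\bigl(1+\mathcal H(u_0^1)+\mathcal H(u_0^2)\bigr).$$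
   Context: A coupling of two laws is a pair of random variables (here processes) on a common probability space having these laws as marginals. $(\mathcal F_t)$ is the filtration generated by the coupling $V=(v_1,v_2)$. $V(\cdot,(v_0^1,v_0^2))$ denotes the coupling associated with the initial conditions $(v_0^1,v_0^2)$. The process $V=(v_1,v_2)$ is said to be $l_0$-Markov if the laws of $V(kT+\cdot)$ and of $l_0(k+\cdot)-k$ (considered jointly) on $\{l_0(k)\in\{k,\infty\}\}$, conditioned by $\mathcal F_{kT}$, depend only on $V(kT)$ and are equal to the laws of $V(\cdot,V(kT))$ and of the associated $l_0$, respectively (with $\infty-k=\infty$). In condition (v), stopping times are understood for the filtration $(\mathcal F_t)$ when $u(\cdot,u_0)$ is realized as a component $u_i$ of the coupling. In (ii), $0^{-q}=+\infty$. $Lip_b(E)$ is the space of bounded Lipschitz real-valued functions on $(E,d_E)$, with norm $\|\varphi\|_L=\|\varphi\|_\infty+L_\varphi$, where $L_\varphi$ is the Lipschitz constant of $\varphi$. *)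

(* Defs.v *)
From HB Require Import structures.
From mathcomp Require Import all_boot all_order all_algebra.
From mathcomp Require Import all_classical all_reals all_analysis.
From mathcomp Require Import measurable_realfun.

Set Implicit Arguments.
Unset Strict Implicit.
Unset Printing Implicit Defensive.

Import Order.TTheory GRing.Theory Num.Theory.
Import numFieldNormedType.Exports.

Local Open Scope classical_set_scope.
Local Open Scope ring_scope.
Local Open Scope ereal_scope.

(* A nonempty complete separable metric space with its Borel sigma-algebra. *)
HB.mixin Record isPolish (d : measure_display) (R : realType) T
    & Metric R T & Complete T & Measurable d T := {
  polish_separable : exists2 D : set T, countable D & dense D ;
  polish_borel : (@measurable d T) = <<s (@open T) >> }.

#[short(type="polishType")]
HB.structure Definition Polish (d : measure_display) (R : realType) :=
  { T of isPolish d R T & Metric R T & Complete T & Measurable d T }.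

Definition sup_norm (R : realType) (E : Type) (phi : E -> R) : R :=
  sup [set `|phi x|%R | x in [set: E]].

Definition lip_const (R : realType) (E : metricType R) (phi : E -> R) : R :=
  sup [set (`|phi z.1 - phi z.2| / mdist z.1 z.2)%R
      | z in [set z : E * E | z.1 != z.2]].

Definition lip_norm (R : realType) (E : metricType R) (phi : E -> R) : R :=
  (sup_norm phi + lip_const phi)%R.

Definition lip_b (R : realType) (E : metricType R) (phi : E -> R) : Prop :=
  (exists M : R, forall x, `|phi x|%R <= M)%R /\
  (exists L : R, forall x y, `|phi x - phi y|%R <= L * mdist x y)%R.

(* Processes are indexed by R; only their values at times of I matter. *)
Definition time_set (R : realType) (T : R) (I : set R) : Prop :=
  I = [set t | (0 <= t)%R] \/ I = [set (k%:R * T)%R | k in [set: nat]].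

Definition coordinate_events (J T : Type) d (S : measurableType d)
    (I : set J) (X : J -> T -> S) : set (set T) :=
  \bigcup_(s in I) preimage_set_system setT (X s) measurable.

(* The paths J -> S, with the sigma-algebra generated by the evaluations at
   the elements of I. *)
Definition path_space (J : Type) (I : set J) d (S : measurableType d) :=
  g_sigma_algebraType (coordinate_events I (fun s (x : J -> S) => x s)).

Definition filtration_of (R : realType) (I : set R) (T : Type) d
    (S : measurableType d) (X : R -> T -> S) (t : R) : set (set T) :=
  <<s coordinate_events (I `&` [set s | (s <= t)%R]) X >>.

Definition stopping_time (R : realType) (I : set R) (T : Type)
    (F : R -> set (set T)) (tau : T -> \bar R) : Prop :=
  (forall w, tau w = +oo \/ exists2 t, I t & tau w = t%:E) /\
  (forall t, I t -> F t [set w | tau w <= t%:E]).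

Definition stopped_events (R : realType) (I : set R) d (T : measurableType d)
    (F : R -> set (set T)) (tau : T -> \bar R) : set (set T) :=
  [set A | measurable A /\
    forall t, I t -> F t (A `&` [set w | tau w <= t%:E])].

(* X x is the process issued from x, so that P (X y t @^-1` A) is the
   transition probability from y to A in time t. Stopping times are those of
   the natural filtration of X x, neither completed nor right-continuous;
   paths are not assumed regular, and the measurability of X at a stopping
   time is part of the property. *)
Definition strong_markov (R : realType) (I : set R) d (Om : measurableType d)
    (P : probability Om R) dE (E : measurableType dE)
    (X : E -> R -> Om -> E) : Prop :=
  [/\ forall x t, I t -> measurable_fun setT (X x t),
      forall x, {ae P, forall w, X x 0%R w = x},
      forall t A, I t -> measurable A ->
        measurable_fun setT (fun x => P (X x t @^-1` A))
    & forall x (tau : Om -> \bar R),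
        stopping_time I (filtration_of I (X x)) tau ->
        (forall A, measurable A ->
           stopped_events I (filtration_of I (X x)) tau
             [set w | tau w < +oo /\ A (X x (fine (tau w)) w)]) /\
        (forall t A B, I t -> measurable A ->
           stopped_events I (filtration_of I (X x)) tau B ->
           P (B `&` [set w | tau w < +oo /\ A (X x (fine (tau w) + t)%R w)]) =
           \int[P]_(w in B `&` [set w | tau w < +oo])
             P (X (X x (fine (tau w)) w) t @^-1` A)) ].

(* The values of l_0, None standing for infinity, with the discrete
   sigma-algebra. *)
Definition natinf := g_sigma_algebraType [set: set (option nat)].

Definition natinf_le (x : option nat) (l : nat) : Prop :=
  if x is Some m then (m <= l)%N else False.

Definition natinf_sub (x : option nat) (k : nat) : option nat :=
  omap (fun m => (m - k)%N) x.

(* A pair of processes V = (v_1, v_2) together with l_0, on their own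
   probability space. *)
Record coupled_process (R : realType) d (S : measurableType d) := {
  cp_display : measure_display ;
  cp_space : measurableType cp_display ;
  cp_prob : probability cp_space R ;
  cp_pair : R -> cp_space -> S * S ;
  cp_l0 : nat -> cp_space -> option nat }.

Arguments cp_pair {R d S} c _ _.
Arguments cp_l0 {R d S} c _ _.

Definition cp_u1 (R : realType) dE (E : measurableType dE) dF
    (F : measurableType dF) (C : coupled_process R (E * F)%type)
    (t : R) (w : cp_space C) : E := (cp_pair C t w).1.1.

Arguments cp_u1 {R dE E dF F} C t w.

Definition cp_u2 (R : realType) dE (E : measurableType dE) dF
    (F : measurableType dF) (C : coupled_process R (E * F)%type)
    (t : R) (w : cp_space C) : E := (cp_pair C t w).2.1.

Arguments cp_u2 {R dE E dF F} C t w.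

Definition cp_H (R : realType) (T : R) dE (E : measurableType dE) dF
    (F : measurableType dF) (H : E -> R)
    (C : coupled_process R (E * F)%type) (k : nat) (w : cp_space C) : R :=
  (H (cp_u1 C (k%:R * T) w) + H (cp_u2 C (k%:R * T) w))%R.

Arguments cp_H {R} T {dE E dF F} H C k w.

Definition path_law (R : realType) (I : set R) d (Om : measurableType d)
    (P : probability Om R) dS (S : measurableType dS) (X : R -> Om -> S)
    (A : set (path_space I S)) : \bar R :=
  P [set w | A (fun t => X t w)].

Definition is_coupling (R : realType) (I : set R) d (Om : measurableType d)
    (P : probability Om R) dS (S : measurableType dS) (X1 X2 : R -> Om -> S)
    (C : coupled_process R S) : Prop :=
  [/\ forall t, I t -> measurable_fun setT (cp_pair C t),
      forall A : set (path_space I S), measurable A ->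
        path_law (cp_prob C) (fun t w => (cp_pair C t w).1) A =
        path_law P X1 A
    & forall A : set (path_space I S), measurable A ->
        path_law (cp_prob C) (fun t w => (cp_pair C t w).2) A =
        path_law P X2 A ].

Definition joint_space (R : realType) (I : set R) d (S : measurableType d) :=
  (path_space I (S * S)%type * path_space [set: nat] natinf)%type.

Definition cp_law (R : realType) (I : set R) d (S : measurableType d)
    (C : coupled_process R S) (A : set (joint_space I S)) : \bar R :=
  cp_prob C [set w | A (fun t => cp_pair C t w, fun j => cp_l0 C j w)].

Definition restart_event (R : realType) d (S : measurableType d)
    (C : coupled_process R S) (k : nat) : set (cp_space C) :=
  [set w | cp_l0 C k w = Some k \/ cp_l0 C k w = None].

Arguments restart_event {R d S} C k.

Definition shifted_event (R : realType) (T : R) (I : set R) d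
    (S : measurableType d) (C : coupled_process R S) (k : nat)
    (A : set (joint_space I S)) : set (cp_space C) :=
  [set w | A (fun t => cp_pair C (k%:R * T + t)%R w,
              fun j => natinf_sub (cp_l0 C (k + j) w) k)].

Arguments shifted_event {R} T {I d S} C k A.

(* g (V(kT)) is a version, on the restart event, of the conditional
   probability given F_{kT} that (V(kT + .), l_0(k + .) - k) is in A. The
   measurable g is needed because the law of C z is not assumed to be
   measurable in z. *)
Definition l0_markov (R : realType) (T : R) (I : set R) d
    (S : measurableType d) (C : S * S -> coupled_process R S) : Prop :=
  forall (z : S * S) (k : nat) (A : set (joint_space I S)), measurable A ->
  exists g : S * S -> \bar R,
    [/\ measurable_fun setT g,
        {ae cp_prob (C z), forall w, restart_event (C z) k w ->
           g (cp_pair (C z) (k%:R * T)%R w) =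
           cp_law (C (cp_pair (C z) (k%:R * T)%R w)) A}
      & forall B, filtration_of I (cp_pair (C z)) (k%:R * T)%R B ->
          cp_prob (C z)
            (B `&` restart_event (C z) k `&` shifted_event T (C z) k A) =
          \int[cp_prob (C z)]_(w in B `&` restart_event (C z) k)
            g (cp_pair (C z) (k%:R * T)%R w) ].

(* Meaningful only when B has positive probability. *)
Definition cond_pr (R : realType) d (Om : measurableType d)
    (P : probability Om R) (A B : set Om) : R :=
  (fine (P (A `&` B)) / fine (P B))%R.

(* s^{-q} for s >= 0, with 0^{-q} = +oo, whereas powR gives 0 `^ (- q) = 0. *)
Definition neg_power (R : realType) (s q : R) : \bar R :=
  if s == 0%R then +oo else (s `^ (- q))%:E.

(* E (X(tau) 1_{tau < oo}) *)
Definition stopped_mean (R : realType) d (Om : measurableType d)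
    (P : probability Om R) (X : R -> Om -> R) (tau : Om -> \bar R) : \bar R :=
  \int[P]_(w in [set w | tau w < +oo]) (X (fine (tau w)) w)%:E.

(* Main.v *)
(** By (iii), each coupling attempt survives forever with probability at least
some kappa > 0, and it fails after m steps with probability O(m^{-1-q}).  Call
k a restart time when l_0(k) is k or infinity.  At restart times where
l_0 = infinity and H_k > R_0, the Lyapunov bound makes E(H_k^eta),
eta = 1/(1+q), contract geometrically over a fixed number of steps, by Jensen's
inequality; a failure after m steps feeds it by O(m^{-q}) only, by interpolation
between the probability of the failure and the bounded mean of H.  Together with
(iv) this turns the probabilities g_k = P(l_0(k) = k) and t_n = P(l_0(N) >= n)
into a renewal system
  kappa sum_{j >= n} g_j <= t_n <= C sum_{j <= n} (g_j + g_{j+1}) (1+n-j)^{-q}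
                                   + C (1+n)^{-q} (1 + H(u_0^1) + H(u_0^2)),
which forces t_n = O(n^{-q}).  With l close to t/(2T), condition (ii) then
compares u_1(t) and u_2(t) outside an event of probability O(t^{-q}). *)

Require Import Defs.
From HB Require Import structures.
From mathcomp Require Import all_boot all_order all_algebra.
From mathcomp Require Import all_classical all_reals all_analysis.
From mathcomp Require Import measurable_realfun.
From mathcomp Require Import ring lra zify.

Set Implicit Arguments.
Unset Strict Implicit.
Unset Printing Implicit Defensive.

Import Order.TTheory GRing.Theory Num.Theory.
Import numFieldNormedType.Exports.

Local Open Scope classical_set_scope.
Local Open Scope ring_scope.

(** * Polynomial decay *)

(** The delicate moment is the return from a failed attempt. There only the mean of H is bounded,
    without uniform integrability, so the mean of H restricted to a failure need not decay with the
    failure probability. A power of H below 1 does decay there, the Lyapunov bound still contracts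
    it, and Markov's inequality turns it back into a probability; this is why [eta] appears. The
    exponent q is any positive number, and for q <= 1 the kernel (1+m)^{-q} is not summable. The
    renewal system therefore cannot be closed by summing the kernel; it is closed because the Cesaro
    means of the kernel tend to 0, while the lower bound with kappa limits the total mass of the g_j
    beyond n by t_n itself. Everything is done at a finite horizon N: the events l_0(N) = j are
    disjoint and each keeps a fraction kappa of g_j, so no limit of l_0 is needed. Finally, the law
    of the coupling need not be measurable in its starting point, so the Markov property is used
    only through inequalities with measurable majorants. *)

Lemma ratio_powR_le (R : realType) (a b c q : R) : 0 < a -> 0 < b -> 0 < c ->
  0 <= q -> b <= c * a -> a `^ (- q) <= c `^ q * b `^ (- q).
Proof.
move=> a0 b0 c0 q0 bca; rewrite !powRN ler_pdivlMr ?powR_gt0//.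
rewrite mulrC ler_pdivrMr ?powR_gt0// -powRM ?(ltW a0) ?(ltW c0)//.
by apply: ge0_ler_powR; rewrite ?nnegrE ?mulr_ge0// ltW.
Qed.

(** The shift to [m.+1] keeps the base at least 1: the kernel equals 1 at 0 and decreases both in m
    and in the exponent. *)
Definition decay (R : realType) (q : R) (m : nat) : R := m.+1%:R `^ (- q).

Section decay.
Context {R : realType}.
Implicit Types (q c : R) (m n a b : nat).

Lemma decay_gt0 q m : 0 < decay q m.
Proof. by rewrite powR_gt0. Qed.

Lemma decay_ge0 q m : 0 <= decay q m.
Proof. exact: powR_ge0. Qed.

Lemma decay0 q : decay q 0 = 1.
Proof. by rewrite /decay powR1. Qed.

(** A linear change of argument costs only a constant; this allows the passages from n to n/4 and
    from t to t/(2T). *)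
Lemma decay_scale q c a b : 0 <= q -> 0 < c -> a.+1%:R <= c * b.+1%:R ->
  decay q b <= c `^ q * decay q a.
Proof.
by move=> q0 c0 ab; apply: ratio_powR_le.
Qed.

Lemma decay_le q a b : 0 <= q -> (a <= b)%N -> decay q b <= decay q a.
Proof.
move=> q0 ab; have := @decay_scale q 1 a b q0 ltr01.
by rewrite powR1 !mul1r ler_nat; apply.
Qed.

Lemma decay_le1 q m : 0 <= q -> decay q m <= 1.
Proof. by move=> q0; rewrite -(decay0 q) decay_le. Qed.

Lemma decay_leq q r m : q <= r -> decay r m <= decay q m.
Proof. by move=> qr; rewrite ler_powR ?ler1n// lerN2. Qed.

Lemma decayD q r m : decay (q + r) m = decay q m * decay r m.
Proof. by rewrite /decay opprD powRD// pnatr_eq0 implybT. Qed.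

(* With x = m + 2, ln ((x - 1) / x) <= - 1 / x, so
   ((x - 1) / x) ^ (- b) = exp (- b ln ((x - 1) / x)) >= 1 + b / x. *)
Lemma decay_telescope q m : 0 <= q ->
  q * decay (1 + q) m.+1 <= decay q m - decay q m.+1.
Proof.
move=> q0.
have x0 : 0 < m.+2%:R :> R by [].
have x1 : 0 < m.+1%:R :> R by [].
suff : (1 + q / m.+2%:R) * decay q m.+1 <= decay q m.
  rewrite mulrDl mul1r lerBrDl addrC; apply: le_trans; rewrite addrC lerD2l.
  by rewrite decayD mulrA [decay 1 _]powR_inv1.
rewrite -ler_pdivlMr ?decay_gt0// /decay -powRN opprK.
have -> : m.+2%:R `^ q = (m.+1%:R * (m.+2%:R / m.+1%:R)) `^ q :> R.
  by congr (_ `^ _); rewrite mulrC divfK ?gt_eqF.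
rewrite powRM ?divr_ge0// mulrA.
rewrite -powRD ?pnatr_eq0 ?implybT// addNr powRr0 mul1r.
rewrite /powR gt_eqF ?divr_gt0//; apply: le_trans (expR_ge1Dx _).
rewrite lerD2l ler_wpM2l// -[X in ln X]invf_div lnV ?posrE ?divr_gt0// lerNr.
have -> : m.+1%:R / m.+2%:R = 1 + - m.+2%:R^-1 :> R.
  by rewrite -{1}(addrK 1 m.+1%:R) natr1 mulrBl divff ?gt_eqF// div1r.
by apply: le_ln1Dx; rewrite ltrN2 invf_lt1// ltr1n.
Qed.

Lemma decay_sum q m n : 0 < q ->
  \sum_(m <= i < n) decay (1 + q) i <= (1 + q^-1) * decay q m.
Proof.
move=> q0; have [nm|mn] := leqP n m.
  by rewrite big_geq// mulr_ge0 ?addr_ge0 ?invr_ge0 ?ltW// decay_gt0.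
(* The subtracted remainder lets the telescoping induction close. The 1 in [1 + q^-1] pays for the
   first term, which [decay_telescope] does not cover. *)
suff H k : \sum_(m <= i < m + k.+1) decay (1 + q) i <=
    (1 + q^-1) * decay q m - q^-1 * decay q (m + k).
  rewrite -(subnKC mn) addSn -addnS; apply: le_trans (H _) _.
  by rewrite gerBl mulr_ge0 ?invr_ge0 ?ltW// decay_gt0.
elim: k => [|k IH].
  rewrite addn1 big_nat1 addn0 mulrDl mul1r addrK.
  by apply: decay_leq; rewrite lerDr.
rewrite addnS big_nat_recr/=; last by rewrite leq_addr.
apply: le_trans (lerD IH (lexx _)) _.
have := decay_telescope (m + k) (ltW q0).
rewrite addnS -(@ler_pM2l _ q^-1) ?invr_gt0// mulKf ?gt_eqF// mulrBr => H.
by rewrite -addrA lerD2l -lerBrDl opprK [leRHS]addrC.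
Qed.

Lemma decay_small q c : 0 < q -> 0 < c ->
  exists n, forall m, (n <= m)%N -> decay q m <= c.
Proof.
move=> q0 c0; exists (Num.bound (c `^ (- q^-1))) => m nm.
apply: le_trans (decay_le (ltW q0) nm) _.
have h : c `^ (- q^-1) <= (Num.bound (c `^ (- q^-1))).+1%:R.
  apply/ltW/(lt_trans (archi_boundP (powR_ge0 _ _))).
  by rewrite ltr_nat.
rewrite /decay powRN invf_ple ?posrE ?powR_gt0//.
apply: le_trans (ge0_ler_powR (ltW q0) _ _ h); rewrite ?nnegrE ?powR_ge0//.
by rewrite -powRrM mulNr mulVf ?gt_eqF// powR_inv1 ?(ltW c0).
Qed.

(** The kernel varies slowly: a shift by M divides it by at most (1 + M/(m+1))^q, which tends to 1.
    A contraction by rho over M steps thus dominates the decrease of the kernel over the same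
    steps. *)
Lemma decay_slow q (rho rho' : R) M : 0 < q -> 0 < rho -> rho < rho' ->
  exists n, forall m, (n <= m)%N -> rho * decay q m <= rho' * decay q (m + M).
Proof.
move=> q0 r0 rr'.
have x1 : 1 < (rho' / rho) by rewrite ltr_pdivlMr// mul1r.
pose l := ln (rho' / rho).
have l0 : 0 < l by rewrite ln_gt0.
have r'0 : 0 < rho' by apply: lt_trans rr'.
exists (Num.bound (q * M%:R / l)) => m nm.
have h : q * (M%:R / m.+1%:R) <= l.
  rewrite mulrA ler_pdivrMr// [leRHS]mulrC -ler_pdivrMr//.
  apply/ltW/(lt_le_trans (archi_boundP _)).
    by rewrite divr_ge0 ?mulr_ge0// ltW.
  by rewrite ler_nat; apply: leqW.
have := @decay_scale q (1 + M%:R / m.+1%:R) (m + M) m (ltW q0).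
have c0 : 0 < 1 + M%:R / m.+1%:R :> R by rewrite ltr_pwDl// divr_ge0.
move=> /(_ c0); rewrite mulrDl mul1r divfK ?pnatr_eq0// -natrD addSn lexx.
move=> /(_ isT) /(ler_wpM2l (ltW r0)) /le_trans; apply.
rewrite mulrA ler_wpM2r ?decay_ge0// mulrC -ler_pdivlMr//.
rewrite /powR gt_eqF// -[leRHS]lnK ?posrE ?divr_gt0// ler_expR.
apply: le_trans h; rewrite ler_wpM2l ?(ltW q0)//; apply: le_ln1Dx.
by apply: (@lt_le_trans _ _ 0); rewrite ?ltrN10// divr_ge0.
Qed.

Lemma decay_cesaro q c : 0 < q -> 0 < c ->
  exists n, forall m, (n <= m)%N -> \sum_(0 <= i < m) decay q i <= c * m%:R.
Proof.
move=> q0 c0; have c20 : 0 < c / 2 by rewrite divr_gt0.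
have [A hA] := decay_small q0 c20.
exists (maxn A (Num.bound (A%:R / (c / 2)))) => m; rewrite geq_max => /andP[Am Bm].
rewrite (big_cat_nat (leq0n A) Am)/=.
have -> : c * m%:R = c / 2 * m%:R + c / 2 * m%:R.
  by rewrite -mulrDl -splitr.
apply: lerD.
  apply: (@le_trans _ _ A%:R).
    apply: (@le_trans _ _ (\sum_(0 <= i < A) 1)); last by rewrite sumr_const_nat subn0.
    by apply: ler_sum => i _; apply/decay_le1/ltW.
  rewrite mulrC -ler_pdivrMr//; apply/ltW/(lt_le_trans (archi_boundP _)).
    by rewrite divr_ge0// ltW.
  by rewrite ler_nat.
apply: (@le_trans _ _ (\sum_(A <= i < m) (c / 2))).
  rewrite [leLHS]big_nat_cond [leRHS]big_nat_cond.
  by apply: ler_sum => i /andP[/andP[Ai _] _]; exact: hA.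
by rewrite sumr_const_nat -[leLHS]mulr_natr ler_pM2l// ler_nat leq_subr.
Qed.

End decay.

(** * Renewal inequalities *)

Section survival.
Context {R : realType} (q c : R) (p : nat -> R).
Hypothesis q_gt0 : 0 < q.
Hypothesis c_ge0 : 0 <= c.
Hypothesis p_gt0 : forall k, 0 < p k.
Hypothesis p_rate : forall k, 1 - p k <= c * decay (1 + q) k.
Implicit Types (s : nat -> R) (m n k : nat).

(** Here [s k] stands for the probability that an attempt begun at a fixed time is still running k
    steps later. Condition (iii) is put in product form, which makes sense for null events too. *)
Definition survives s :=
  [/\ forall k, 0 <= s k, forall k, s k.+1 <= s k &
      forall k, p k * s k <= s k.+1].

Lemma survives_le s m n : survives s -> (m <= n)%N -> s n <= s m.
Proof.
move=> [_ sS _] /subnKC <-; elim: (n - m)%N => [|k IH]; first by rewrite addn0.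
by rewrite addnS (le_trans (sS _)).
Qed.

Lemma survives_loss s k : survives s ->
  s k - s k.+1 <= c * decay (1 + q) k * s k.
Proof.
move=> [s0 _ ps]; apply: le_trans (ler_wpM2r (s0 k) (p_rate k)).
by rewrite mulrBl mul1r lerD2l lerN2.
Qed.

Lemma survives_sum_loss s m n : survives s -> (m <= n)%N ->
  s m - s n <= c * (\sum_(m <= i < n) decay (1 + q) i) * s m.
Proof.
move=> ss mn; rewrite -opprB -(telescope_sumr _ mn) -sumrN mulr_sumr mulr_suml.
rewrite [leLHS]big_nat_cond [leRHS]big_nat_cond.
apply: ler_sum => i /andP[/andP[mi _] _]; rewrite opprB.
apply: le_trans (survives_loss _ ss) _.
by rewrite ler_wpM2l ?mulr_ge0 ?decay_ge0// survives_le.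
Qed.

Lemma survives_tail s m n : survives s -> (m <= n)%N ->
  s m - s n <= c * (1 + q^-1) * decay q m * s m.
Proof.
move=> ss mn; apply: le_trans (survives_sum_loss ss mn) _.
have [s0 _ _] := ss.
by rewrite ler_wpM2r// -mulrA ler_wpM2l// decay_sum.
Qed.

(** Over a window of fixed length the loss keeps the exponent 1 + q, one more than the whole tail.
    The interpolation of the moment of order [eta] consumes exactly this extra factor. *)
Lemma survives_window s m M : survives s ->
  s m - s (m + M)%N <= c * M%:R * decay (1 + q) m * s 0.
Proof.
move=> ss; apply: le_trans (survives_sum_loss ss (leq_addr _ _)) _.
have [s0 _ _] := ss.
apply: ler_pM => //; last exact: survives_le.
  by rewrite mulr_ge0// sumr_ge0// => i _; rewrite decay_ge0.
rewrite -mulrA ler_wpM2l//.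
apply: (@le_trans _ _ (\sum_(m <= i < m + M) decay (1 + q) m)).
  rewrite [leLHS]big_nat_cond [leRHS]big_nat_cond.
  apply: ler_sum => i /andP[/andP[mi _] _].
  by rewrite decay_le// addr_ge0// ltW.
by rewrite sumr_const_nat addKn mulr_natl.
Qed.

(** Beyond some rank n0 the total loss is at most half of what is alive at n0, and the first n0
    steps cost a fixed positive product. *)
Lemma survives_forever : exists2 kappa : R, 0 < kappa &
  forall s n, survives s -> kappa * s 0 <= s n.
Proof.
pose c' := c * (1 + q^-1) + 1.
have c'0 : 0 < c'.
  by rewrite ltr_wpDl// mulr_ge0// addr_ge0// invr_ge0 ltW.
have ic'0 : 0 < (2 * c')^-1 by rewrite invr_gt0 mulr_gt0.
have [n0 hn0] := decay_small q_gt0 ic'0.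
pose P n : R := \prod_(i < n) Num.min (p i) 1.
have P0 n : 0 < P n by rewrite prodr_gt0// => i _; rewrite lt_min p_gt0/=.
have P1 n : P n <= 1.
  apply: prodr_ile1 => i _.
  by rewrite le_min ler01 (ltW (p_gt0 i))/= ge_min lexx orbT.
have sP s n : survives s -> P n * s 0 <= s n.
  move=> [s0 _ ps]; elim: n => [|n IH]; first by rewrite /P big_ord0 mul1r.
  rewrite /P big_ord_recr/= mulrAC mulrC; apply: le_trans (ps n).
  apply: ler_pM => //; first by rewrite le_min ler01 (ltW (p_gt0 n)).
    by rewrite mulr_ge0// ltW// P0.
  by rewrite ge_min lexx.
exists (P n0 / 2); first by rewrite divr_gt0.
move=> s n ss; have [s0 _ _] := ss.
have [nn0|n0n] := leqP n n0.
  apply: le_trans (survives_le ss nn0); apply: le_trans (sP _ _ ss).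
  by rewrite ler_wpM2r// ler_pdivrMr// ler_peMr ?ler1n// ltW.
have h : s n0 - s n <= 2^-1 * s n0.
  apply: le_trans (survives_tail ss (ltnW n0n)) _.
  rewrite ler_wpM2r//; apply: (@le_trans _ _ (c' * decay q n0)).
    by rewrite ler_wpM2r ?decay_ge0// lerDl.
  rewrite mulrC -ler_pdivlMr//; apply: le_trans (hn0 _ (leqnn _)) _.
  by rewrite invfM.
have := sP s n0 ss; rewrite mulrAC; clear - h; lra.
Qed.

End survival.

Section renewal.
Context {R : realType}.
Implicit Types (g t : nat -> R) (n m N : nat).

(* Averaging the renewal inequality over a window [2n, 4n) bounds t (4n) by
   t n times the Cesaro mean of the decay, which is small. *)
Lemma renewal_decay (q kappa C : R) : 0 < q -> 0 < kappa -> 0 <= C ->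
  exists2 C' : R, 0 < C' & forall N (h : R) g t, 1 <= h ->
    (forall j, 0 <= g j) ->
    (forall n m, (n <= m <= N)%N -> t m <= t n) -> t 0%N <= 1 ->
    (forall n, (n <= N)%N -> kappa * \sum_(n <= j < N.+1) g j <= t n) ->
    (forall n, (n < N)%N -> t n <=
       C * (\sum_(j < n.+1) (g j + g j.+1) * decay q (n - j)) +
       C * decay q n * h) ->
    forall n, (n <= N)%N -> t n <= C' * h * decay q n.
Proof.
move=> q0 k0 C0.
pose C1 := C * (2 / kappa) + C.
pose C2 := C / kappa.
have C10 : 0 <= C1 by rewrite addr_ge0// mulr_ge0// divr_ge0// ltW.
have C20 : 0 <= C2 by rewrite divr_ge0// ltW.
pose Q : R := 4 `^ q.
have Q0 : 0 < Q by rewrite powR_gt0.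
(* [Q] is the price of passing from the rate at n/4 to the rate at n. With this [eps] the feedback
   of t (n/4) costs at most half of the bound being proved. *)
pose eps := (2 * Q)^-1.
have eps0 : 0 < eps by rewrite invr_gt0 mulr_gt0.
have e'0 : 0 < eps / (4 * (C2 + 1)).
  by rewrite divr_gt0// mulr_gt0// ltr_wpDl.
have [n0 hn0] := decay_cesaro q0 e'0.
(* The first term ensures (C1 + eps C') Q = Q C1 + C'/2 <= C'; the second makes the bound at least 1
   for n < 4 (n0 + 1), where only t <= 1 is known. *)
pose C' := 2 * Q * C1 + (decay q (4 * n0.+1))^-1.
have C'0 : 0 < C'.
  by rewrite ltr_wpDl ?invr_gt0 ?decay_gt0// !mulr_ge0// ltW.
exists C' => // N h g t h1 g0 tmon t01 gt tg.
have h0 : 0 < h by apply: lt_le_trans h1.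
have sum_g n m : (n <= N)%N -> (n <= m <= N.+1)%N ->
    \sum_(n <= j < m) g j <= t n / kappa.
  move=> nN /andP[nm mN].
  rewrite ler_pdivlMr// mulrC; apply: le_trans (gt n nN).
  by rewrite ler_pM2l// [leRHS](big_cat_nat nm mN)/= lerDl sumr_ge0.
have sum_gS n m : (n <= N)%N -> (n <= m <= N)%N ->
    \sum_(n <= j < m) (g j + g j.+1) <= 2 * t n / kappa.
  move=> nN /andP[nm mN]; rewrite big_split/= -mulrA mulr_natl mulr2n lerD//.
    by rewrite sum_g// nm leqW.
  rewrite -(big_add1 _ _ n m.+1 xpredT g) /=.
  apply: le_trans (sum_g n m.+1 nN _); last by rewrite ltnS mN leqW.
  by rewrite [leRHS]big_ltn ?ltnS// lerDr.
(* For m >= 2n, the indices j < n lie at distance at least n from m and contribute [decay q n] times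
   a bounded mass. The indices j >= n have mass at most 2 t n / kappa, and each meets the kernel
   summed along the window. *)
have key n : (0 < n)%N -> (4 * n <= N)%N ->
    t (4 * n)%N <= C1 * h * decay q n +
                  C2 / n%:R * (\sum_(0 <= i < 4 * n) decay q i) * t n.
  move=> n_gt0 nN; set E := \sum_(0 <= i < _) _.
  have n4 : (n <= 4 * n)%N by rewrite leq_pmull.
  have nN' : (n <= N)%N by rewrite (leq_trans n4).
  (* The test is needed once the sums are exchanged: for j > m the truncated difference m - j is 0,
     and the kernel would give 1. *)
  pose b m j := if (j <= m)%N then decay q (m - j) else 0.
  have b0 m j : 0 <= b m j by rewrite /b; case: ifP; rewrite // decay_ge0.
  have g20 j : 0 <= g j + g j.+1 by rewrite addr_ge0.
  have step m : (2 * n <= m < 4 * n)%N -> t m <= C1 * h * decay q n +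
      C * \sum_(n <= j < 4 * n) (g j + g j.+1) * b m j.
    move=> /andP[nm m4n]; apply: le_trans (tg m (leq_trans m4n nN)) _.
    have nm' : (n <= m)%N by clear - nm; lia.
    rewrite -(big_mkord xpredT (fun j => (g j + g j.+1) * decay q (m - j))).
    rewrite (big_cat_nat (leq0n n) (leqW nm'))/= mulrDr.
    have S1 : \sum_(0 <= j < n) (g j + g j.+1) * decay q (m - j) <=
        2 / kappa * decay q n.
      apply: (@le_trans _ _ (\sum_(0 <= j < n) (g j + g j.+1) * decay q n)).
        rewrite [leLHS]big_nat_cond [leRHS]big_nat_cond.
        apply: ler_sum => j /andP[/andP[_ jn] _].
        by rewrite ler_wpM2l// decay_le ?(ltW q0)//; clear - jn nm; lia.
      rewrite -mulr_suml ler_wpM2r ?decay_ge0//.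
      apply: le_trans (sum_gS 0%N n _ _) _ => //.
      by rewrite ler_pM2r ?invr_gt0// ger_pMr.
    have S2 : \sum_(n <= j < m.+1) (g j + g j.+1) * decay q (m - j) <=
        \sum_(n <= j < 4 * n) (g j + g j.+1) * b m j.
      rewrite [leRHS](big_cat_nat (leqW nm') m4n)/= -[leLHS]addr0 lerD//.
        rewrite [leLHS]big_nat_cond [leRHS]big_nat_cond.
        by apply: ler_sum => j /andP[/andP[_ jm] _]; rewrite /b -ltnS jm.
      by apply: sumr_ge0 => j _; rewrite mulr_ge0.
    have S3 : C * decay q m * h <= C * h * decay q n.
      by rewrite mulrAC ler_wpM2l ?(mulr_ge0 C0 (ltW h0))// decay_le// ltW.
    apply: le_trans (lerD (lerD (ler_wpM2l C0 S1) (ler_wpM2l C0 S2)) S3) _.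
    rewrite addrAC lerD2r /C1 (mulrDl _ C) (mulrDl _ (C * h)) lerD2r mulrA.
    by rewrite ler_wpM2r ?decay_ge0// ler_peMr// mulr_ge0// divr_ge0// ltW.
  have sumt : (2 * n)%:R * t (4 * n)%N <= \sum_(2 * n <= m < 4 * n) t m.
    have -> : (2 * n)%:R * t (4 * n)%N = \sum_(2 * n <= m < 4 * n) t (4 * n)%N.
      by rewrite sumr_const_nat mulr_natl; congr (_ *+ _); clear; lia.
    rewrite [leLHS]big_nat_cond [leRHS]big_nat_cond.
    by apply: ler_sum => m /andP[/andP[_ mn] _]; rewrite tmon// nN ltnW.
  have sumb : \sum_(2 * n <= m < 4 * n)
      \sum_(n <= j < 4 * n) (g j + g j.+1) * b m j <= 2 * t n / kappa * E.
    rewrite exchange_big_nat/=.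
    apply: (@le_trans _ _ (\sum_(n <= j < 4 * n) (g j + g j.+1) * E)).
      rewrite [leLHS]big_nat_cond [leRHS]big_nat_cond.
      apply: ler_sum => j /andP[/andP[_ jn] _].
      rewrite -mulr_sumr ler_wpM2l//.
      apply: (@le_trans _ _ (\sum_(0 <= m < 4 * n) b m j)).
        have h2 : (2 * n <= 4 * n)%N by rewrite leq_mul.
        by rewrite [leRHS](big_cat_nat (leq0n (2 * n)) h2)/= lerDr sumr_ge0.
      rewrite (big_cat_nat (leq0n j) (ltnW jn))/= big_nat_cond big1 ?add0r; last first.
        by move=> i /andP[/andP[_ ij] _]; rewrite /b leqNgt ij.
      rewrite -{1}[j]add0n big_addn [E](big_cat_nat (leq0n (4 * n - j)) (leq_subr j _))/=.
      rewrite -[leLHS]addr0 lerD//; last by apply: sumr_ge0 => *; exact: decay_ge0.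
      by apply: ler_sum => i _; rewrite /b leq_addl addnK.
    rewrite -mulr_suml ler_wpM2r ?sumr_ge0// => [i _|]; first exact: decay_ge0.
    by rewrite sum_gS// n4.
  have n20 : 0 < (2 * n)%:R :> R by rewrite ltr0n muln_gt0.
  rewrite -(ler_pM2l n20); apply: le_trans sumt _.
  apply: (@le_trans _ _ (\sum_(2 * n <= m < 4 * n) (C1 * h * decay q n +
      C * \sum_(n <= j < 4 * n) (g j + g j.+1) * b m j))).
    rewrite [leLHS]big_nat_cond [leRHS]big_nat_cond.
    by apply: ler_sum => m /andP[mn _]; exact: step.
  rewrite big_split/= sumr_const_nat mulrDr lerD//.
    by rewrite mulr_natl; apply/ler_wpMn2l; rewrite ?mulr_ge0 ?decay_ge0 ?(ltW h0)//; clear; lia.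
  rewrite -mulr_sumr; apply: le_trans (ler_wpM2l C0 sumb) _.
  rewrite /C2 natrM le_eqVlt; apply/orP; left; apply/eqP.
  by field; rewrite ?(gt_eqF k0) ?pnatr_eq0 ?gtn_eqF.
move=> n; elim/ltn_ind: n => n IH nN.
have [n_small|n_big] := ltnP n (4 * n0.+1).
  apply: (@le_trans _ _ 1); first by apply: le_trans t01; rewrite tmon ?nN.
  have C'1 : 1 <= C' * decay q n.
    rewrite -ler_pdivrMr ?decay_gt0// div1r.
    apply: (@le_trans _ _ (decay q (4 * n0.+1))^-1).
      by rewrite lef_pV2 ?posrE ?decay_gt0// decay_le ?(ltW q0)// ltnW.
    by rewrite lerDr !mulr_ge0// ltW.
  by rewrite mulrAC; apply: le_trans C'1 _; rewrite ler_peMr// ltW ?mulr_gt0 ?decay_gt0.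
pose n' := (n %/ 4)%N.
have n4 : (4 * n' <= n)%N by rewrite mulnC leq_trunc_div.
have nS4 : (n < 4 * n'.+1)%N by rewrite mulnC -ltn_divLR.
have n'0 : (n0 < n')%N by clear - nS4 n_big; lia.
have n'_gt0 : (0 < n')%N by exact: leq_ltn_trans n'0.
apply: (@le_trans _ _ (t (4 * n')%N)); first by rewrite tmon ?n4.
apply: le_trans (key n' n'_gt0 (leq_trans n4 nN)) _.
have n'n : (n' < n)%N by clear - n'_gt0 n4; lia.
have tn' : t n' <= C' * h * decay q n'.
  by apply: IH => //; rewrite (leq_trans (ltnW n'n)).
have t0n' : 0 <= t n'.
  apply: le_trans (gt n' _); last by rewrite (leq_trans (ltnW n'n)).
  by rewrite mulr_ge0 ?(ltW k0)// sumr_ge0.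
have coef : C2 / n'%:R * (\sum_(0 <= i < 4 * n') decay q i) <= eps.
  apply: (@le_trans _ _ (C2 / n'%:R * (eps / (4 * (C2 + 1)) * (4 * n')%:R))).
    apply: ler_wpM2l; first exact: divr_ge0.
    by apply: hn0; clear - n'0; lia.
  have -> : C2 / n'%:R * (eps / (4 * (C2 + 1)) * (4 * n')%:R) =
      eps * (C2 / (C2 + 1)).
    by rewrite natrM; field; rewrite ?(gt_eqF (ltr_wpDl C20 ltr01)) ?pnatr_eq0 ?gtn_eqF.
  by rewrite ler_piMr ?(ltW eps0)// ler_pdivrMr ?ltr_wpDl// mul1r lerDl.
have dn' : decay q n' <= Q * decay q n.
  by apply: decay_scale; rewrite ?(ltW q0)// -natrM ler_nat.
apply: (@le_trans _ _ ((C1 + eps * C') * h * decay q n')).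
  rewrite !mulrDl lerD2l; apply: le_trans (ler_wpM2r t0n' coef) _.
  by rewrite -!mulrA ler_pM2l// mulrA.
have Ch0 : 0 <= (C1 + eps * C') * h.
  by rewrite mulr_ge0 ?(ltW h0)// addr_ge0// mulr_ge0 ?ltW.
apply: le_trans (ler_wpM2l Ch0 dn') _.
rewrite mulrA ler_wpM2r ?decay_ge0// mulrAC ler_pM2r//.
have -> : (C1 + eps * C') * Q = Q * C1 + C' / 2.
  by rewrite /eps; field; rewrite gt_eqF.
suff : 2 * Q * C1 <= C' by clear; lra.
by rewrite lerDl invr_ge0 decay_ge0.
Qed.

End renewal.

(** * Excursions above the level R0 and the reduction to real sequences *)

Section coupling_scheme.
Context {R : realType}.
Implicit Types (g l x y : nat -> R) (n m N M : nat).

(** A geometric contraction forgets faster than any power, so the response to a source convolved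
    with the kernel keeps the rate q. The induction needs [rho * F m <= rho' * F (m + M)] at every
    rank, small ones included, with some rho' < 1; hence the kernel [F], started at the rank given
    by [decay_slow]. *)
Lemma excursion_decay (q A rho : R) M : 0 < q -> 0 <= A -> 0 < rho < 1 ->
  (0 < M)%N ->
  exists2 B : R, 0 <= B & forall (h : R) (a y : nat -> R), 0 <= h -> (forall j, 0 <= a j) ->
    (forall n, (n < M)%N -> y n <= A * h) ->
    (forall n, y (n + M)%N <= rho * y n +
       A * \sum_(j < n.+1) a j * decay q (n - j)) ->
    forall n, y n <= B * (\sum_(j < n.+1) a j * decay q (n - j)) +
                     B * decay q n * h.
Proof.
move=> q0 A0 /andP[r0 r1] M0.
pose rho' := (1 + rho) / 2.
have rr' : rho < rho' by rewrite /rho'; clear - r1; lra.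
have r'1 : rho' < 1 by rewrite /rho'; clear - r1; lra.
have r'0 : 0 < rho' by apply: lt_trans rr'.
have [m0 hm0] := decay_slow M q0 r0 rr'.
pose F m := decay q (m0 + m).
pose Q : R := m0.+1%:R `^ q.
have Q0 : 0 < Q by rewrite powR_gt0.
have F0 m : 0 < F m by exact: decay_gt0.
have QF m : decay q m <= Q * F m.
  apply: decay_scale; rewrite ?(ltW q0)// -natrM ler_nat; clear; lia.
have Fd m : F m <= decay q m by rewrite decay_le ?(ltW q0)// leq_addl.
have FM m : rho * F m <= rho' * F (m + M)%N.
  by rewrite /F addnA hm0// leq_addr.
(* The first term is the fixed point of B = (B + A Q / rho) rho', the inductive step; the second
   covers the ranks below M. *)
pose B1 := A * Q * rho' / (rho * (1 - rho')) + A / F M.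
have r'10 : 0 < 1 - rho' by rewrite subr_gt0.
have P0 : 0 <= A * Q * rho' / (rho * (1 - rho')).
  apply: divr_ge0; first exact: mulr_ge0 (mulr_ge0 A0 (ltW Q0)) (ltW r'0).
  exact: mulr_ge0 (ltW r0) (ltW r'10).
have B10 : 0 <= B1 by exact: addr_ge0 P0 (divr_ge0 A0 (ltW (F0 M))).
have B1r : (B1 + A * Q / rho) * rho' <= B1.
  rewrite mulrDl -lerBrDl -[X in X - _]mulr1 -mulrBr mulrDl.
  have -> : A * Q * rho' / (rho * (1 - rho')) * (1 - rho') = A * Q / rho * rho'.
    by field; rewrite (gt_eqF r0) (gt_eqF r'10).
  by rewrite lerDl mulr_ge0 ?divr_ge0// ltW.
exists B1 => // h a y h0 a0 ybase ystep.
pose S n := \sum_(j < n.+1) a j * F (n - j)%N.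
have S0 n : 0 <= S n by apply: sumr_ge0 => j _; rewrite mulr_ge0// ltW.
suff H n : y n <= B1 * S n + B1 * F n * h.
  move=> n; apply: le_trans (H n) _; apply: lerD.
    rewrite ler_wpM2l//; apply: ler_sum => j _; exact: ler_wpM2l.
  by rewrite ler_wpM2r// ler_wpM2l.
elim/ltn_ind: n => n IH.
have [nM|Mn] := ltnP n M.
  apply: le_trans (ybase n nM) _.
  rewrite -[leLHS]add0r lerD ?mulr_ge0// ler_wpM2r//.
  apply: (@le_trans _ _ (A / F M * F M)); first by rewrite divfK// gt_eqF.
  apply: ler_pM; [exact: divr_ge0 A0 (ltW (F0 M))|exact: ltW| |].
    by rewrite lerDr.
  by rewrite decay_le ?(ltW q0)// leq_add2l ltnW.
rewrite -(subnK Mn); set k := (n - M)%N.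
have kn : (k < n)%N by rewrite /k; clear - M0 Mn; lia.
apply: le_trans (ystep k) _.
have Ssum : \sum_(j < k.+1) a j * decay q (k - j) <= Q * S k.
  rewrite mulr_sumr; apply: ler_sum => j _.
  by rewrite mulrCA ler_wpM2l.
have SM : rho * S k <= rho' * S (k + M)%N.
  rewrite !mulr_sumr.
  rewrite -(big_mkord xpredT (fun j => rho * (a j * F (k - j)%N))).
  rewrite -(big_mkord xpredT (fun j => rho' * (a j * F (k + M - j)%N))).
  have kM : (k.+1 <= (k + M).+1)%N by rewrite ltnS leq_addr.
  rewrite [leRHS](big_cat_nat (leq0n _) kM)/= -[leLHS]addr0 lerD//.
    rewrite [leLHS]big_nat_cond [leRHS]big_nat_cond.
    apply: ler_sum => j /andP[/andP[_ jk] _].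
    have -> : (k + M - j = k - j + M)%N by clear - jk; lia.
    by rewrite mulrCA [leRHS]mulrCA ler_wpM2l.
  apply: sumr_ge0 => j _.
  exact: mulr_ge0 (ltW r'0) (mulr_ge0 (a0 j) (ltW (F0 _))).
apply: (@le_trans _ _ (rho * (B1 * S k + B1 * F k * h) + A * (Q * S k))).
  apply: lerD; last exact: ler_wpM2l.
  by apply: ler_wpM2l; [exact: ltW|exact: IH].
have -> : rho * (B1 * S k + B1 * F k * h) + A * (Q * S k) =
    (B1 + A * Q / rho) * (rho * S k) + B1 * h * (rho * F k).
  by field; rewrite (gt_eqF r0).
apply: lerD.
  apply: (@le_trans _ _ ((B1 + A * Q / rho) * (rho' * S (k + M)%N))).
    apply: ler_wpM2l => //; apply: addr_ge0 => //.
    exact: divr_ge0 (mulr_ge0 A0 (ltW Q0)) (ltW r0).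
  by rewrite mulrA ler_wpM2r.
rewrite [leRHS]mulrAC ler_wpM2l ?mulr_ge0//.
by apply: le_trans (FM k) _; rewrite ler_piMl// ltW.
Qed.

(** Dictionary: [s j k] is the probability of l_0(k) = j, [l k] and [x k] those of l_0(k) = infinity
    with H_k at most R0 and above R0, [y k] the moment of order [eta] of H_k on the last event, and
    [h] is 1 plus the initial values of H. *)
Lemma coupling_scheme_decay (q c A pm rho : R) (p : nat -> R) M :
  0 < q -> 0 <= c -> 0 <= A -> 0 < pm -> 0 < rho < 1 -> (0 < M)%N ->
  (forall k, 0 < p k) -> (forall k, 1 - p k <= c * decay (1 + q) k) ->
  exists2 C : R, 0 < C & forall (h : R) (s : nat -> nat -> R) l x y,
    1 <= h -> (forall j, survives p (fun i => s j (j + i)%N)) ->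
    (forall k, 0 <= l k) -> (forall k, 0 <= x k) ->
    (forall k, \sum_(j < k.+1) s j k + (l k + x k) = 1) ->
    (forall k, pm * l k <= s k.+1 k.+1) ->
    (forall k, x k <= A * y k) ->
    (forall k, (k < M)%N -> y k <= A * h) ->
    (forall k, y (k + M)%N <= rho * y k + A * (s k k + l k) +
       A * \sum_(j < k) s j j * decay q (k - j)) ->
    forall n N, (n <= N)%N -> 1 - \sum_(j < n) s j N <= C * h * decay q n.
Proof.
move=> q0 c0 A0 pm0 r01 M0 p0 prate.
have [kappa kappa0 hkappa] := survives_forever q0 c0 p0 prate.
have [B B0 hB] := excursion_decay q0 A0 r01 M0.
pose b := 1 + pm^-1.
have b0 : 0 < b by rewrite addr_gt0// invr_gt0.
pose C3 := c * (1 + q^-1).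
have C30 : 0 <= C3 by rewrite mulr_ge0// addr_ge0// invr_ge0 ltW.
pose D := b * (1 + A * B) + C3.
have AB0 : 0 <= A * B by rewrite mulr_ge0.
have D0 : 0 <= D by rewrite addr_ge0// mulr_ge0 ?ltW// ltr_wpDr.
have [C C0 hC] := renewal_decay q0 kappa0 D0.
exists C => // h s l x y h1 ss l0 x0 tot pl xy ybase ystep n N nN.
pose g j := s j j.
have h0 : 0 <= h by apply: le_trans h1.
have s0 j k : (j <= k)%N -> 0 <= s j k.
  by move=> /subnKC <-; have [+ _ _] := ss j; apply.
have g0 j : 0 <= g j by exact: s0.
have ly : forall n, y n <= B * (\sum_(j < n.+1) (g j + l j) * decay q (n - j)) +
                     B * decay q n * h.
  apply: (hB h (fun j => g j + l j) y) => // [j|k]; first by rewrite addr_ge0.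
  apply: le_trans (ystep k) _; rewrite -addrA lerD2l -mulrDr ler_wpM2l//.
  rewrite [leRHS]big_ord_recr/= subnn decay0 mulr1 addrC; apply: lerD => //.
  by apply: ler_sum => j _; rewrite ler_wpM2r ?decay_ge0// lerDl.
(* By (iv), the mass at infinity with H below R0 at time j is paid for by the attempts begun at j +
   1; this is the origin of [g j.+1] in the renewal system. *)
have gl j : g j + l j <= b * (g j + g j.+1).
  rewrite /b mulrDl mul1r.
  have : l j <= pm^-1 * g j.+1 by rewrite mulrC ler_pdivlMr// mulrC.
  have : 0 <= pm^-1 * g j by rewrite mulr_ge0// invr_ge0 ltW.
  have := g0 j.+1; clear; lra.
apply: (hC N h g (fun n => 1 - \sum_(j < n) s j N)) => //.
- move=> m k /andP[mk kN]; rewrite lerD2l lerN2.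
  rewrite -!(big_mkord xpredT (fun j => s j N)).
  rewrite [leRHS](big_cat_nat (leq0n _) mk)/= lerDl big_nat_cond.
  by apply: sumr_ge0 => j /andP[/andP[_ jk] _]; rewrite s0// ltnW// (leq_trans jk).
- by rewrite big_ord0 subr0.
- move=> m mN; rewrite lerBrDr -(tot N).
  apply: (@le_trans _ _ (\sum_(j < N.+1) s j N)); last first.
    by rewrite lerDl addr_ge0.
  rewrite -!(big_mkord xpredT (fun j => s j N)).
  rewrite [leRHS](big_cat_nat (leq0n _) (leqW mN))/= [leLHS]addrC lerD2l mulr_sumr.
  rewrite [leLHS]big_nat_cond [leRHS]big_nat_cond.
  apply: ler_sum => j /andP[/andP[_ jN] _].
  by have := hkappa _ (N - j)%N (ss j); rewrite addn0 subnKC.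
- move=> m mN.
  have tail (j : 'I_m) : s j m - s j N <= C3 * (g j * decay q (m - j)).
    have jm : (m - j <= N - j)%N by rewrite leq_sub2r// ltnW.
    have := survives_tail q0 c0 prate (ss j) jm.
    rewrite !subnKC ?(ltnW (ltn_ord j))//; last first.
      exact/ltnW/(ltn_trans (ltn_ord j)).
    move=> /le_trans; apply; rewrite -/C3 -mulrA ler_wpM2l// mulrC.
    rewrite ler_wpM2r ?decay_ge0//.
    have := survives_le (ss j) (leq0n (m - j)).
    by rewrite addn0 subnKC// ltnW.
  (* The mass outside earlier attempts at time N is the same mass at time m, plus what these
     attempts lose between m and N. *)
  have -> : 1 - \sum_(j < m) s j N =
      (g m + l m) + x m + \sum_(j < m) (s j m - s j N).
    rewrite sumrB -(tot m) big_ord_recr/= /g; ring.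
  pose S := \sum_(j < m.+1) (g j + g j.+1) * decay q (m - j).
  have u0 j : 0 <= g j + g j.+1 by rewrite addr_ge0.
  have S0 : 0 <= S by apply: sumr_ge0 => j _; rewrite mulr_ge0 ?decay_ge0.
  have S1 : g m + l m <= b * S.
    apply: le_trans (gl m) _; rewrite ler_wpM2l ?(ltW b0)//.
    rewrite /S big_ord_recr/= subnn decay0 mulr1 lerDr sumr_ge0// => j _.
    by rewrite mulr_ge0 ?decay_ge0.
  have S2 : \sum_(j < m.+1) (g j + l j) * decay q (m - j) <= b * S.
    rewrite mulr_sumr; apply: ler_sum => j _.
    by rewrite mulrA ler_wpM2r ?decay_ge0.
  have S3 : \sum_(j < m) (s j m - s j N) <= C3 * S.
    apply: (@le_trans _ _ (\sum_(j < m) C3 * (g j * decay q (m - j)))).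
      by apply: ler_sum => j _; exact: tail.
    rewrite -mulr_sumr ler_wpM2l// /S big_ord_recr/= -[leLHS]addr0 lerD//.
      by apply: ler_sum => j _; rewrite ler_wpM2r ?decay_ge0// lerDl.
    by rewrite mulr_ge0 ?decay_ge0.
  have S4 : x m <= A * B * (b * S) + A * B * decay q m * h.
    apply: le_trans (xy m) _; apply: le_trans (ler_wpM2l A0 (ly m)) _.
    by rewrite mulrDr !mulrA -!(mulrA (A * B)) lerD2r ler_wpM2l.
  apply: le_trans (lerD (lerD S1 S4) S3) _.
  have -> : b * S + (A * B * (b * S) + A * B * decay q m * h) + C3 * S =
      D * S + A * B * decay q m * h by rewrite /D; ring.
  rewrite lerD2l -!mulrA mulrA ler_wpM2r ?mulr_ge0 ?decay_ge0//.
  rewrite /D; apply: (@le_trans _ _ (b * (1 + A * B))); last by rewrite lerDl.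
  have b1 : 1 <= b by rewrite lerDl invr_ge0 ltW.
  apply: (@le_trans _ _ (1 + A * B)); first by rewrite lerDr.
  by rewrite ler_peMl// addr_ge0.
Qed.

End coupling_scheme.
(** * The Markov property of the coupling *)

Section layers.
Context {R : realType}.

Local Open Scope ereal_scope.

(* Summed over i, the layers of s > 0 give s rounded up to a multiple of dl. *)
Definition layer (dl s : R) (i : nat) : R := dl * ((i%:R * dl < s)%R)%:R.

Lemma layer_ge0 dl s i : (0 <= dl)%R -> (0 <= layer dl s i)%R.
Proof. by move=> dl0; rewrite mulr_ge0. Qed.

Lemma nneseries_layer_le (dl s : R) : (0 < dl)%R -> (0 <= s)%R ->
  \sum_(0 <= i <oo) (layer dl s i)%:E <= (s + dl)%:E.
Proof.
move=> dl0 s0; apply: lime_le.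
  by apply: is_cvg_nneseries => i _ _; rewrite lee_fin layer_ge0// ltW.
apply: nearW => n; rewrite sumEFin lee_fin.
(* The bound by [s + dl] is not inductive alone: a new layer is added only when n dl < s, and it is
   then the bound by n dl that leaves room for it. *)
suff [] : (\sum_(0 <= i < n) layer dl s i <= n%:R * dl /\
          \sum_(0 <= i < n) layer dl s i <= s + dl)%R by [].
elim: n => [|n [IH1 IH2]].
  by rewrite big_geq// mul0r addr_ge0// ltW.
rewrite big_nat_recr//= /layer; case: ltP => ns.
  rewrite mulr1 -natr1 mulrDl mul1r !lerD2r; split => //.
  exact: le_trans IH1 (ltW ns).
rewrite mulr0 addr0; split => //; apply: le_trans IH1 _.
by rewrite ler_wpM2r ?ler_nat// ltW.
Qed.

Lemma nneseries_layer_ge (dl s : R) : (0 < dl)%R ->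
  s%:E <= \sum_(0 <= i <oo) (layer dl s i)%:E.
Proof.
move=> dl0; set n := Num.bound `|s / dl|%R.
apply: le_trans (@nneseries_lim_ge _ _ xpredT 0%N n _); last first.
  by move=> i _ _; rewrite lee_fin layer_ge0// ltW.
rewrite sumEFin lee_fin.
have sn : (s <= n%:R * dl)%R.
  rewrite -ler_pdivrMr//; apply: le_trans (ler_norm _) _.
  by apply/ltW/archi_boundP.
suff H m : (Num.min s (m%:R * dl) <= \sum_(0 <= i < m) layer dl s i)%R.
  by apply: le_trans (H n); rewrite le_min lexx.
elim: m => [|m IH]; first by rewrite big_geq// mul0r ge_min lexx orbT.
rewrite big_nat_recr//= /layer; case: (boolP (m%:R * dl < s)%R) IH => [ms|].
  rewrite min_r ?(ltW ms)// mulr1 -natr1 mulrDl mul1r => IH.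
  by rewrite ge_min lerD2r IH orbT.
by rewrite -leNgt => ms; rewrite min_l// mulr0 addr0 => IH; rewrite ge_min IH.
Qed.

Context {d} {Om : measurableType d} (P : probability Om R).
Variables (dl : R) (X : Om -> R).
Hypothesis dl_gt0 : (0 < dl)%R.
Hypothesis X_ge0 : forall w, (0 <= X w)%R.
Hypothesis X_meas : measurable_fun setT X.

Let levelE i w : (layer dl (X w) i)%:E =
  dl%:E * (\1_[set w | (i%:R * dl < X w)%R] w)%:E.
Proof. by rewrite /layer indicE mem_setE EFinM. Qed.

Let measurable_level i : measurable [set w | (i%:R * dl < X w)%R].
Proof. by rewrite -[X in measurable X]setTI; apply: measurable_fun_ltr. Qed.

Let measurable_layer i D :
  measurable D -> measurable_fun D (fun w => (layer dl (X w) i)%:E).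
Proof.
move=> mD; under eq_fun do rewrite levelE.
by apply: measurable_funeM; apply: measurableT_comp.
Qed.

Lemma integral_layers B : measurable B ->
  \sum_(0 <= i <oo) dl%:E * P (B `&` [set w | (i%:R * dl < X w)%R]) =
  \int[P]_(w in B) \sum_(0 <= i <oo) (layer dl (X w) i)%:E.
Proof.
move=> mB; rewrite integral_nneseries//; last 2 first.
- by move=> i; exact: measurable_layer.
- by move=> i w _; rewrite lee_fin layer_ge0// ltW.
apply: eq_eseriesr => i _.
under eq_integral do rewrite levelE.
rewrite ge0_integralZl_EFin ?(ltW dl_gt0)//.
  by rewrite integral_indic// setIC.
by apply: measurableT_comp.
Qed.

Lemma measurable_layers D : measurable D ->
  measurable_fun D (fun w => \sum_(0 <= i <oo) (layer dl (X w) i)%:E).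
Proof.
move=> mD; apply: (ge0_emeasurable_sum (P := xpredT)) => [i w _ _|i _].
  by rewrite lee_fin layer_ge0// ltW.
exact: measurable_layer.
Qed.

Lemma integral_le_layers B : measurable B ->
  \int[P]_(w in B) (X w)%:E <=
  \sum_(0 <= i <oo) dl%:E * P (B `&` [set w | (i%:R * dl < X w)%R]).
Proof.
move=> mB; rewrite integral_layers//; apply: ge0_le_integral => //.
- by move=> w _; rewrite lee_fin.
- by apply: measurableT_comp => //; exact: measurable_funTS.
- exact: measurable_layers.
- by move=> w _; exact: nneseries_layer_ge.
Qed.

Lemma layers_le_integral :
  \sum_(0 <= i <oo) dl%:E * P [set w | (i%:R * dl < X w)%R] <=
  \int[P]_w (X w)%:E + dl%:E.
Proof.
under eq_eseriesr do rewrite -[[set _ | _]]setTI.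
rewrite integral_layers//.
apply: (@le_trans _ _ (\int[P]_w ((X w)%:E + dl%:E))).
  apply: ge0_le_integral => //.
  - by move=> w _; apply: nneseries_ge0 => i _ _; rewrite lee_fin layer_ge0// ltW.
  - exact: measurable_layers.
  - by apply: emeasurable_funD => //; exact: measurableT_comp.
  - by move=> w _; exact: nneseries_layer_le.
rewrite ge0_integralD//.
- rewrite leeD2l// integral_cst// -[leRHS]mule1 lee_pmul2l// ?lte_fin//.
  exact: probability_le1.
- by move=> w _; rewrite lee_fin.
- exact: measurableT_comp.
- by move=> w _; rewrite lee_fin ltW.
Qed.

End layers.

Section coupled.
Context {R : realType} (T : R) (I : set R) {d} {S : measurableType d}.
Variable C : S * S -> coupled_process R S.
Hypothesis C_meas : forall z t, I t -> measurable_fun setT (cp_pair (C z) t).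

Local Open Scope ereal_scope.

Lemma filtration_measurable z t B :
  filtration_of I (cp_pair (C z)) t B -> measurable B.
Proof.
apply: smallest_sub; first exact: sigma_algebra_measurable.
move=> A [s [Is _] [D mD <-]]; exact: C_meas.
Qed.

Lemma filtration_coordinate z t (D : set (S * S)) : I t -> measurable D ->
  filtration_of I (cp_pair (C z)) t (cp_pair (C z) t @^-1` D).
Proof.
move=> It mD; apply: sub_sigma_algebra; exists t; first by split => /=.
by exists D => //; rewrite setTI.
Qed.

Lemma filtration_setI z t A B :
  filtration_of I (cp_pair (C z)) t A -> filtration_of I (cp_pair (C z)) t B ->
  filtration_of I (cp_pair (C z)) t (A `&` B).
Proof.
move=> FA FB; pose G := coordinate_events (I `&` [set s | (s <= t)%R]) (cp_pair (C z)).
exact: (@measurableI _ (g_sigma_algebraType G)).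
Qed.

(* Only the events {h(V) > i dl} have conditional probabilities given by
   l0_markov, so h is compared with the sum of their indicators. *)
Lemma markov_integral_le z (k : nat) (t : R) (h : S * S -> R)
    (phi : cp_space (C z) -> R) B :
  l0_markov T I C -> I (k%:R * T)%R -> I t -> I (k%:R * T + t)%R ->
  (forall v, 0 <= h v)%R -> measurable_fun setT h ->
  (forall w, 0 <= phi w)%R -> measurable_fun setT phi ->
  filtration_of I (cp_pair (C z)) (k%:R * T) B ->
  B `<=` restart_event (C z) k ->
  (forall w, B w ->
     \int[cp_prob (C (cp_pair (C z) (k%:R * T)%R w))]_x
       (h (cp_pair (C (cp_pair (C z) (k%:R * T)%R w)) t x))%:E <= (phi w)%:E) ->
  \int[cp_prob (C z)]_(w in B) (h (cp_pair (C z) (k%:R * T + t)%R w))%:E <=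
  \int[cp_prob (C z)]_(w in B) (phi w)%:E.
Proof.
move=> CM Ik It Ikt h0 mh phi0 mphi FB BR hphi.
have mB := filtration_measurable FB.
set P := cp_prob (C z).
(* The mesh [dl] is also the error: rounding h up to its layers costs at most [dl] on a probability
   space. *)
apply/lee_addgt0Pr => dl dl0.
pose A i : set (joint_space I S) := [set y | (i%:R * dl < h (y.1 t))%R].
have mD i : measurable [set v | (i%:R * dl < h v)%R].
  by rewrite -[X in measurable X]setTI; apply: measurable_fun_ltr.
have mA i : measurable (A i).
  rewrite -[A i]setTI.
  apply: (@measurable_fst _ _ _ _ measurableT
    [set x : path_space I (S * S)%type | (i%:R * dl < h (x t))%R]).
  apply: sub_sigma_algebra; exists t => //.
  by exists [set v | (i%:R * dl < h v)%R] => //; rewrite setTI.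
have [g hg] := choice (fun i => CM z k _ (mA i)).
(* Off the restart event nothing is known about the sign of [g i]; the positive part agrees almost
   surely with it on the restart event and makes the series below nonnegative everywhere. *)
pose gp i w := maxe (g i (cp_pair (C z) (k%:R * T)%R w)) 0.
have gp0 i w : 0 <= gp i w by rewrite le_max lexx orbT.
have mgp i : measurable_fun setT (gp i).
  have [mg _ _] := hg i.
  apply: measurable_maxe; last exact: measurable_cst.
  exact: (measurableT_comp mg (@C_meas z _ Ik)).
have gpE : {ae P, forall w, forall i, restart_event (C z) k w ->
    gp i w = cp_law (C (cp_pair (C z) (k%:R * T)%R w)) (A i)}.
  apply: ae_foralln => i; have [_ + _] := hg i.
  apply: filterS => w /= gw Rw; rewrite /gp gw// max_l//.
have PB i : P (B `&` [set w | (i%:R * dl < h (cp_pair (C z) (k%:R * T + t)%R w))%R])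
    = \int[P]_(w in B) gp i w.
  have [mg gae gint] := hg i.
  have := gint _ FB; rewrite (setIidl BR) => ->.
  apply: ae_eq_integral => //.
  - by apply: (measurable_funS measurableT) => //; exact: measurableT_comp mg (@C_meas z _ Ik).
  - exact: (measurable_funS measurableT).
  - apply: filterS gae => w /= gw Bw; rewrite /gp max_l// gw//; exact: BR.
have mh' : measurable_fun setT (fun w => h (cp_pair (C z) (k%:R * T + t)%R w)).
  exact: (measurableT_comp mh (@C_meas z _ Ikt)).
apply: le_trans (integral_le_layers P dl0 _ mh' mB) _ => //.
under eq_eseriesr do rewrite PB.
have dl0' : (0 <= dl)%R by exact: ltW.
under eq_eseriesr => i _.
  rewrite -ge0_integralZl_EFin//; last exact: (measurable_funTS (mgp i)).
  over.
have mdgp i : measurable_fun B (fun w => dl%:E * gp i w).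
  by apply: measurable_funeM; exact: (measurable_funTS (mgp i)).
have dgp0 i w : 0 <= dl%:E * gp i w by rewrite mule_ge0 ?lee_fin.
rewrite -integral_nneseries//.
apply: (@le_trans _ _ (\int[P]_(w in B) ((phi w)%:E + dl%:E))); last first.
  rewrite ge0_integralD//; last 2 first.
  - by move=> w _; rewrite lee_fin.
  - by apply: measurableT_comp => //; exact: measurable_funTS.
  rewrite leeD2l// integral_cst// -[leRHS]mule1 lee_pmul2l// ?lte_fin//.
  exact: probability_le1.
(* The expectation under the restarted coupling need not be measurable in w. It occurs only
   pointwise, between the measurable series of the [gp i] and the measurable [phi w + dl]. *)
apply: ae_ge0_le_integral => //.
- by move=> w _; apply: nneseries_ge0.
- by apply: (ge0_emeasurable_sum (P := xpredT)).
- by move=> w _; rewrite adde_ge0// lee_fin.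
- apply: emeasurable_funD => //.
  by apply: measurableT_comp => //; exact: measurable_funTS.
- apply: filterS gpE => w gw Bw.
  rewrite (eq_eseriesr (fun i _ => congr1 (mule dl%:E) (gw i (BR w Bw)))).
  apply: le_trans (leeD2r _ (hphi w Bw)).
  apply: layers_le_integral => //.
  exact: (measurableT_comp mh (@C_meas _ _ It)).
Qed.

End coupled.

(** * Fractional moments by concavity *)

Section power.
Context {R : realType}.
Implicit Types (x a eta : R).

(* Young's inequality for x ^ eta * a ^ (1 - eta): the tangent of the concave
   function x ^ eta at a. *)
Lemma powR_tangent x a eta : 0 < eta < 1 -> 0 <= x -> 0 < a ->
  x `^ eta <= (1 - eta) * a `^ eta + eta * a `^ (eta - 1) * x.
Proof.
move=> /andP[e0 e1] x0 a0.
have e1' : 0 < 1 - eta by rewrite subr_gt0.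
have := @conjugate_powR _ (x `^ eta) (a `^ (1 - eta)) eta^-1 (1 - eta)^-1.
rewrite !powR_ge0 !invr_gt0 !invrK -!powRrM !divff ?gt_eqF// !powRr1 ?(ltW a0)//.
move=> /(_ isT isT e0 e1'); rewrite subrKC => /(_ erefl).
have ap : 0 < a `^ (eta - 1) by rewrite powR_gt0.
move=> /(ler_wpM2r (ltW ap)).
rewrite -[leLHS]mulrA -powRD ?(gt_eqF a0) ?implybT//.
rewrite addrA subrK subrr powRr0 mulr1 => /le_trans; apply.
rewrite mulrDl [leRHS]addrC; apply: lerD; first by rewrite [x * eta]mulrC mulrAC.
rewrite mulrAC mulrC ler_wpM2l ?(ltW e1')//.
by rewrite mulr_powRB1// ltW.
Qed.

(** Interpolation with a free threshold a: a large a favours the mean of x, a small a the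
    probability of the event on which it is integrated. *)
Lemma powR_le_add x a eta : 0 < eta < 1 -> 0 <= x -> 0 < a ->
  x `^ eta <= a `^ eta + a `^ (eta - 1) * x.
Proof.
move=> /andP[e0 e1] x0 a0; apply: le_trans (powR_tangent _ x0 a0) _.
  by rewrite e0.
apply: lerD; first by rewrite ler_piMl ?powR_ge0// gerBl ltW.
by rewrite -mulrA ler_piMl ?mulr_ge0 ?powR_ge0// ltW.
Qed.

Lemma powR_le1D x eta : 0 < eta < 1 -> 0 <= x -> x `^ eta <= 1 + x.
Proof.
by move=> e x0; have := powR_le_add e x0 ltr01; rewrite !powR1 mul1r.
Qed.

End power.

Section integral_bounds.
Context {R : realType} {d} {Om : measurableType d} (P : probability Om R).
Local Open Scope ereal_scope.

(** Jensen's inequality, by integrating the tangent at a. As the tangent is increasing, a may be any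
    upper bound of the mean. *)
Lemma integral_powR_le (X : Om -> R) (a eta : R) :
  (0 < eta < 1)%R -> (0 < a)%R -> (forall w, 0 <= X w)%R ->
  measurable_fun setT X ->
  \int[P]_w (X w)%:E <= a%:E -> \int[P]_w (X w `^ eta)%:E <= (a `^ eta)%:E.
Proof.
move=> e01 a0 X0 mX Xa; have /andP[e0 e1] := e01.
pose b : R := ((1 - eta) * a `^ eta)%R; pose c : R := (eta * a `^ (eta - 1))%R.
have b0 : (0 <= b)%R by rewrite mulr_ge0 ?powR_ge0// subr_ge0 ltW.
have c0 : (0 <= c)%R by rewrite mulr_ge0 ?powR_ge0// ltW.
have mX' : measurable_fun setT (fun w => (X w)%:E) by exact: measurableT_comp.
apply: (@le_trans _ _ (\int[P]_w (b%:E + c%:E * (X w)%:E))).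
  apply: ge0_le_integral => //.
  - by move=> w _; rewrite lee_fin powR_ge0.
  - apply: measurableT_comp => //.
    exact: (measurableT_comp (@measurable_powR R eta) mX).
  - by apply: emeasurable_funD => //; exact: measurable_funeM.
  - by move=> w _; rewrite lee_fin; exact: powR_tangent.
rewrite ge0_integralD//; last 2 first.
- by move=> w _; rewrite mule_ge0 ?lee_fin.
- exact: measurable_funeM.
rewrite ge0_integralZl_EFin//; last by move=> w _; rewrite lee_fin.
apply: (@le_trans _ _ (b%:E + c%:E * a%:E)).
  apply: leeD; last exact: lee_wpmul2l.
  rewrite integral_cst// -[leRHS]mule1 lee_wpmul2l// ?lee_fin//.
  exact: probability_le1.
rewrite -EFinM -EFinD lee_fin /b /c -mulrA [(a `^ _ * a)%R]mulrC.
by rewrite mulr_powRB1 ?(ltW a0)// -mulrDl subrK mul1r.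
Qed.

Lemma ge0_integral_setU_le (f : Om -> \bar R) A B D :
  measurable A -> measurable B -> measurable D -> measurable_fun setT f ->
  (forall w, 0 <= f w) -> A `<=` B `|` D ->
  \int[P]_(w in A) f w <= \int[P]_(w in B) f w + \int[P]_(w in D) f w.
Proof.
move=> mA mB mD mf f0 ABD.
have mf' E : measurable_fun E f by exact: measurable_funTS.
apply: (@le_trans _ _ (\int[P]_(w in B `|` D) f w)).
  by apply: ge0_subset_integral => //; exact: measurableU.
have -> : B `|` D = B `|` D `\` B.
  by apply/seteqP; split => w /=; have [] := pselect (B w); tauto.
have mDB : measurable (D `\` B) by exact: measurableD.
rewrite ge0_integral_setU//; last first.
  by apply/disj_setPS => w [Bw [_ nBw]].
by rewrite leeD2l//; apply: ge0_subset_integral => // w [].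
Qed.

End integral_bounds.
Lemma le_sum4 (R : realType) (a b c d : R) : 0 <= a -> 0 <= b -> 0 <= c -> 0 <= d ->
  [/\ a <= a + b + c + d, b <= a + b + c + d, c <= a + b + c + d & d <= a + b + c + d].
Proof. by move=> *; split; lra. Qed.

(** * The tail of l_0 under the coupling *)

Section coupling_time.
Context {R : realType} {dE dF dO : measure_display}.
Context {E : measurableType dE} {F : measurableType dF}.
Variables (T : R) (I : set R).
Hypotheses (T_gt0 : 0 < T) (I_time : time_set T I).
Context {Om : measurableType dO} (P : probability Om R).
Variables (u : E -> R -> Om -> E) (W : F -> R -> Om -> F).
Hypothesis u_meas : forall x t, I t -> measurable_fun setT (u x t).
Hypothesis W_meas : forall x t, I t -> measurable_fun setT (W x t).
Variable C : (E * F) * (E * F) -> coupled_process R (E * F)%type.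
Hypothesis C_coupling : forall z,
  is_coupling I P (fun t w => (u z.1.1 t w, W z.1.2 t w))
                  (fun t w => (u z.2.1 t w, W z.2.2 t w)) (C z).

Local Notation V z := (cp_pair (C z)).
Local Notation PC z := (cp_prob (C z)).

Lemma time_set_mul k : I (k%:R * T).
Proof.
case: I_time => ->; last by exists k.
by rewrite /= mulr_ge0// ltW.
Qed.

Lemma time_set_ge0 t : I t -> 0 <= t.
Proof.
case: I_time => -> //= [k _ <-].
by rewrite mulr_ge0// ltW.
Qed.

Lemma coupling_measurable z t : I t -> measurable_fun setT (V z t).
Proof. by move=> It; have [+ _ _] := C_coupling z; apply. Qed.

Local Open Scope ereal_scope.

Lemma path_event_measurable t (A : set (E * F)) : I t -> measurable A ->
  measurable [set x : path_space I (E * F)%type | A (x t)].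
Proof.
move=> It mA; apply: sub_sigma_algebra; exists t => //.
by exists A => //; rewrite setTI.
Qed.

Lemma coupling_integral1 z t (f : E * F -> \bar R) : I t ->
  measurable_fun setT f -> (forall v, 0 <= f v) ->
  \int[PC z]_w f (V z t w).1 = \int[P]_w f (u z.1.1 t w, W z.1.2 t w).
Proof.
move=> It mf f0; have [mV law1 _] := C_coupling z.
have mV1 : measurable_fun setT (fun w => (V z t w).1).
  exact: (measurableT_comp (@measurable_fst _ _ _ _) (mV t It)).
have mu : measurable_fun setT (fun w => (u z.1.1 t w, W z.1.2 t w)).
  by apply: measurable_fun_pair; [exact: u_meas|exact: W_meas].
have := @ge0_integral_pushforward _ _ _ _ _ _ mV1 (PC z) _ f measurableT mf (fun y _ => f0 y).
rewrite preimage_setT => <-.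
have := @ge0_integral_pushforward _ _ _ _ _ _ mu P _ f measurableT mf (fun y _ => f0 y).
rewrite preimage_setT => <-.
apply: eq_measure_integral => A mA _.
exact: (law1 _ (path_event_measurable It mA)).
Qed.

Lemma coupling_integral2 z t (f : E * F -> \bar R) : I t ->
  measurable_fun setT f -> (forall v, 0 <= f v) ->
  \int[PC z]_w f (V z t w).2 = \int[P]_w f (u z.2.1 t w, W z.2.2 t w).
Proof.
move=> It mf f0; have [mV _ law2] := C_coupling z.
have mV2 : measurable_fun setT (fun w => (V z t w).2).
  exact: (measurableT_comp (@measurable_snd _ _ _ _) (mV t It)).
have mu : measurable_fun setT (fun w => (u z.2.1 t w, W z.2.2 t w)).
  by apply: measurable_fun_pair; [exact: u_meas|exact: W_meas].
have := @ge0_integral_pushforward _ _ _ _ _ _ mV2 (PC z) _ f measurableT mf (fun y _ => f0 y).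
rewrite preimage_setT => <-.
have := @ge0_integral_pushforward _ _ _ _ _ _ mu P _ f measurableT mf (fun y _ => f0 y).
rewrite preimage_setT => <-.
apply: eq_measure_integral => A mA _.
exact: (law2 _ (path_event_measurable It mA)).
Qed.

Variable H : E -> R.
Hypotheses (H_ge0 : forall x, (0 <= H x)%R) (H_meas : measurable_fun setT H).
Variables (alpha K1 : R).
Hypothesis lyapunov : forall x t, I t ->
  'E_P[fun w => H (u x t w)] <= (expR (- alpha * t) * H x + K1 / 2)%:E.

Let Hs (v : (E * F) * (E * F)) : R := (H v.1.1 + H v.2.1)%R.

Let Hs_ge0 v : (0 <= Hs v)%R. Proof. by rewrite addr_ge0. Qed.

Let measurable_Hs : measurable_fun setT Hs.
Proof.
apply: measurable_funD; apply: (measurableT_comp H_meas).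
  by apply: (measurableT_comp (@measurable_fst _ _ _ _)).
by apply: (measurableT_comp (@measurable_fst _ _ _ _)).
Qed.

(** No sign of K1 is assumed; the maximum keeps the additive constants nonnegative, and 4 K < R0
    survives because R0 > 0. *)
Let K := Num.max K1 0%R.

Let K_ge0 : (0 <= K)%R. Proof. by rewrite le_max lexx orbT. Qed.

Lemma coupling_lyapunov z t : I t ->
  \int[PC z]_w (Hs (V z t w))%:E <= (expR (- alpha * t) * Hs z + K)%:E.
Proof.
move=> It; have mV := @coupling_measurable z _ It.
have mH : measurable_fun setT (fun v : E * F => (H v.1)%:E).
  apply: measurableT_comp => //.
  exact: (measurableT_comp H_meas (@measurable_fst _ _ _ _)).
under eq_integral do rewrite /Hs EFinD.
rewrite ge0_integralD//; last 4 first.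
- by move=> w _; rewrite lee_fin.
- exact: (measurableT_comp mH (measurableT_comp (@measurable_fst _ _ _ _) mV)).
- by move=> w _; rewrite lee_fin.
- exact: (measurableT_comp mH (measurableT_comp (@measurable_snd _ _ _ _) mV)).
rewrite (@coupling_integral1 _ _ (fun v => (H v.1)%:E))//; last first.
  by move=> v; rewrite lee_fin.
rewrite (@coupling_integral2 _ _ (fun v => (H v.1)%:E))//; last first.
  by move=> v; rewrite lee_fin.
have h1 := @lyapunov z.1.1 _ It; have h2 := @lyapunov z.2.1 _ It.
rewrite unlock in h1; rewrite unlock in h2.
apply: le_trans (leeD h1 h2) _; rewrite -EFinD lee_fin.
have K1K : (K1 <= K)%R by rewrite le_max lexx.
rewrite /Hs mulrDr addrACA lerD2l; apply: le_trans K1K.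
by rewrite -splitr.
Qed.


Hypothesis C_markov : l0_markov T I C.
Variables (d0 R0 q : R).
Hypothesis l0_back : forall z (l k : nat) w, (l <= k)%N ->
  cp_l0 (C z) k.+1 w = Some l -> cp_l0 (C z) k w = Some l.
Hypothesis l0_range : forall z k w, cp_l0 (C z) k w = None \/
  exists2 l, (l <= k)%N & cp_l0 (C z) k w = Some l.
Hypothesis l0_adapted : forall z k (a : option nat),
  filtration_of I (V z) (k%:R * T)%R [set w | cp_l0 (C z) k w = a].
Hypothesis l0_start : forall z k w, cp_l0 (C z) k w = Some k ->
  (cp_H T H (C z) k w <= d0)%R.
Hypotheses (d0R0 : (d0 <= R0)%R) (R0_gt0 : (0 < R0)%R).
Hypotheses (R0_gt : (4 * K1 < R0)%R) (alpha_gt0 : (0 < alpha)%R).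
Hypothesis q_gt0 : (0 < q)%R.

(* With this exponent, the two terms of failure_step are both O(m^{-q}) when
   L = m^{1+q} and the failing event has probability O(m^{-1-q}). *)
Let eta := ((1 + q)^-1)%R.

Let eta01 : (0 < eta < 1)%R.
Proof.
have q1 : (0 < 1 + q)%R by rewrite addr_gt0.
by rewrite invr_gt0 q1 invf_lt1// ltrDl.
Qed.

Let coupled z j k := [set w | cp_l0 (C z) k w = Some j].
Let low z k := [set w | cp_l0 (C z) k w = None /\ (cp_H T H (C z) k w <= R0)%R].
Let high z k := [set w | cp_l0 (C z) k w = None /\ (R0 < cp_H T H (C z) k w)%R].

Arguments coupled : clear implicits.
Arguments low : clear implicits.
Arguments high : clear implicits.

Let cp_HE z k w : cp_H T H (C z) k w = Hs (V z (k%:R * T)%R w).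
Proof. by []. Qed.

Let cp_H_ge0 z k w : (0 <= cp_H T H (C z) k w)%R.
Proof. exact: Hs_ge0. Qed.

Let measurable_cp_H z k : measurable_fun setT (cp_H T H (C z) k).
Proof. exact: (measurableT_comp measurable_Hs (@coupling_measurable z _ (time_set_mul k))). Qed.

Let filtration_coupled z j k : filtration_of I (V z) (k%:R * T)%R (coupled z j k).
Proof. exact: l0_adapted. Qed.

Let measurable_Hs_le r : measurable [set v | (Hs v <= r)%R].
Proof. by rewrite -[X in measurable X]setTI; apply: measurable_fun_ler. Qed.

Let measurable_Hs_gt r : measurable [set v | (r < Hs v)%R].
Proof. by rewrite -[X in measurable X]setTI; apply: measurable_fun_ltr. Qed.

Let filtration_low z k : filtration_of I (V z) (k%:R * T)%R (low z k).
Proof.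
exact: (filtration_setI (@l0_adapted z k None)
  (@filtration_coordinate _ _ _ _ C z _ _ (time_set_mul k) (measurable_Hs_le R0))).
Qed.

Let filtration_high z k : filtration_of I (V z) (k%:R * T)%R (high z k).
Proof.
exact: (filtration_setI (@l0_adapted z k None)
  (@filtration_coordinate _ _ _ _ C z _ _ (time_set_mul k) (measurable_Hs_gt R0))).
Qed.

Let measurable_coupled z j k : measurable (coupled z j k).
Proof. exact: (filtration_measurable coupling_measurable (@filtration_coupled z j k)). Qed.

Let measurable_low z k : measurable (low z k).
Proof. exact: (filtration_measurable coupling_measurable (@filtration_low z k)). Qed.

Let measurable_high z k : measurable (high z k).
Proof. exact: (filtration_measurable coupling_measurable (@filtration_high z k)). Qed.

Let markov_le z k m (h : (E * F) * (E * F) -> R) (phi : cp_space (C z) -> R) B :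
  (forall v, 0 <= h v)%R -> measurable_fun setT h ->
  (forall w, 0 <= phi w)%R -> measurable_fun setT phi ->
  filtration_of I (V z) (k%:R * T)%R B -> B `<=` restart_event (C z) k ->
  (forall w, B w -> \int[PC (V z (k%:R * T)%R w)]_x
     (h (V (V z (k%:R * T)%R w) (m%:R * T)%R x))%:E <= (phi w)%:E) ->
  \int[PC z]_(w in B) (h (V z ((k + m)%:R * T)%R w))%:E <=
  \int[PC z]_(w in B) (phi w)%:E.
Proof.
move=> h0 mh phi0 mphi FB BR hphi; rewrite natrD mulrDl.
apply: (markov_integral_le coupling_measurable C_markov) => //; try exact: time_set_mul.
by rewrite -mulrDl -natrD; exact: time_set_mul.
Qed.

Let lyapunov_le z t : I t -> \int[PC z]_w (Hs (V z t w))%:E <= (Hs z + K)%:E.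
Proof.
move=> It; apply: le_trans (coupling_lyapunov z It) _.
rewrite lee_fin lerD2r ler_piMl// -expR0 ler_expR mulNr oppr_le0.
by rewrite mulr_ge0 ?(ltW alpha_gt0)// time_set_ge0.
Qed.

Let integral_cstE z (r : R) B : measurable B ->
  \int[PC z]_(w in B) r%:E = r%:E * PC z B.
Proof. by move=> mB; rewrite integral_cst. Qed.

(** After a restart below R0 the Lyapunov bound caps the mean of H at all later times. The factor
    [PC z B], absent from the global Lyapunov bound, is what makes the failures proportional to the
    g_j. *)
Let restart_low z k B : B `<=` restart_event (C z) k `&`
    [set w | (cp_H T H (C z) k w <= R0)%R] ->
  filtration_of I (V z) (k%:R * T)%R B -> forall m,
  \int[PC z]_(w in B) (cp_H T H (C z) (k + m) w)%:E <= (R0 + K)%:E * PC z B.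
Proof.
move=> BR FB m; rewrite -integral_cstE; last first.
  exact: (filtration_measurable coupling_measurable FB).
apply: (@markov_le _ _ _ Hs (fun=> (R0 + K)%R)) => //.
- by move=> _; rewrite addr_ge0// ltW.
- by move=> w /BR[].
- move=> w /BR[_ /= Hw]; apply: le_trans (lyapunov_le _ (time_set_mul m)) _.
  by rewrite lee_fin lerD2r.
Qed.

Let restart_low_powR z k B : B `<=` restart_event (C z) k `&`
    [set w | (cp_H T H (C z) k w <= R0)%R] ->
  filtration_of I (V z) (k%:R * T)%R B -> forall m,
  \int[PC z]_(w in B) (cp_H T H (C z) (k + m) w `^ eta)%:E <=
  (1 + (R0 + K))%:E * PC z B.
Proof.
move=> BR FB m.
have mB := filtration_measurable coupling_measurable FB.
have mX := @measurable_cp_H z (k + m).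
apply: (@le_trans _ _
  (\int[PC z]_(w in B) (1 + (cp_H T H (C z) (k + m) w)%:E))).
  apply: ge0_le_integral => //.
  - by move=> w _; rewrite lee_fin powR_ge0.
  - apply: measurable_funTS; apply: measurableT_comp => //.
    exact: (measurableT_comp (@measurable_powR R eta) mX).
  - apply: measurable_funTS; apply: emeasurable_funD => //.
    exact: measurableT_comp.
  - by move=> w _; rewrite -EFinD lee_fin; exact: powR_le1D.
rewrite ge0_integralD//; last 2 first.
- by move=> w _; rewrite lee_fin cp_H_ge0.
- by apply: measurable_funTS; exact: measurableT_comp.
rewrite integral_cstE// EFinD ge0_muleDl ?lee_fin//; last first.
  by rewrite addr_ge0// ltW.
by rewrite leeD2l// restart_low.
Qed.


Let K_small : (4 * K < R0)%R.
Proof. by rewrite /K maxr_pMr ?mulr0// gt_max R0_gt R0_gt0. Qed.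

Let contraction_time : exists2 M : nat, (0 < M)%N &
  (expR (- alpha * (M%:R * T)) <= 4^-1)%R.
Proof.
have aT : (0 < alpha * T)%R by rewrite mulr_gt0.
(* The value 3 suffices since exp 3 >= 1 + 3 = 4. *)
exists (Num.bound (3 / (alpha * T))).+1 => //; set M := _.+1.
have h : (3 <= alpha * (M%:R * T))%R.
  rewrite mulrCA -ler_pdivrMr//; apply/ltW/(lt_le_trans (archi_boundP _)).
    by rewrite divr_ge0// ltW.
  by rewrite ler_nat.
rewrite mulNr expRN lef_pV2 ?posrE ?expR_gt0//.
apply: le_trans (expR_ge1Dx _); apply: le_trans (lerD (lexx 1%R) h).
by rewrite -natr1 addrC.
Qed.

(** Above R0 > 4K the constant K is at most H_k / 4, so after M steps the conditional mean of H is
    at most H_k / 4 + H_k / 4; Jensen's inequality then gives the factor 2^{-eta}. *)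
Let high_step z k M : (expR (- alpha * (M%:R * T)) <= 4^-1)%R ->
  \int[PC z]_(w in high z k) (cp_H T H (C z) (k + M) w `^ eta)%:E <=
  (2^-1 `^ eta)%:E * \int[PC z]_(w in high z k) (cp_H T H (C z) k w `^ eta)%:E.
Proof.
move=> hM; have mX := @measurable_cp_H z k.
have mXe : measurable_fun setT (fun w => cp_H T H (C z) k w `^ eta)%R.
  exact: (measurableT_comp (@measurable_powR R eta) mX).
rewrite -ge0_integralZl_EFin ?powR_ge0//; last 2 first.
- by move=> w _; rewrite lee_fin powR_ge0.
- by apply: measurable_funTS; exact: measurableT_comp.
under [leRHS]eq_integral do rewrite -EFinM.
apply: (@markov_le z k M (fun v => Hs v `^ eta)%R
  (fun w => 2^-1 `^ eta * cp_H T H (C z) k w `^ eta)%R) => //.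
- by move=> v; exact: powR_ge0.
- exact: (measurableT_comp (@measurable_powR R eta) measurable_Hs).
- by move=> w; rewrite mulr_ge0 ?powR_ge0.
- exact: measurable_funM.
- by move=> w [l0N _]; right.
move=> w [_ /= Hw]; set z' := V z _ w.
rewrite -powRM ?invr_ge0//.
apply: integral_powR_le => //.
- by rewrite mulr_gt0// ?invr_gt0// (lt_trans R0_gt0).
- exact: (measurableT_comp measurable_Hs (@coupling_measurable _ _ (time_set_mul M))).
apply: le_trans (coupling_lyapunov z' (time_set_mul M)) _.
rewrite lee_fin; apply: (@le_trans _ _ (4^-1 * Hs z' + 4^-1 * Hs z')%R).
  apply: lerD; first by rewrite ler_wpM2r.
  rewrite mulrC ler_pdivlMr// mulrC; apply/ltW/(lt_trans K_small).
  exact: Hw.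
rewrite -mulrDl; have -> : (4^-1 + 4^-1 = 2^-1 :> R)%R by field.
by rewrite cp_HE.
Qed.

Let coupled_sub z j k k' : (j <= k <= k')%N ->
  coupled z j k' `<=` coupled z j k.
Proof.
move=> /andP[jk /subnKC <-]; elim: (k' - k)%N => [|n IH]; first by rewrite addn0.
rewrite addnS => w /(l0_back (leq_trans jk (leq_addr n k))) /=; exact: IH.
Qed.

Let coupled_restart z j : coupled z j j `<=` restart_event (C z) j `&`
    [set w | (cp_H T H (C z) j w <= R0)%R].
Proof.
move=> w l0w; split; first by left.
by rewrite /=; apply: le_trans d0R0; exact: l0_start.
Qed.

Let failure_step z j k M (L : R) : (j <= k)%N -> (0 < L)%R ->
  \int[PC z]_(w in coupled z j k `&` high z (k + M))
     (cp_H T H (C z) (k + M) w `^ eta)%:E <=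
  (L `^ eta)%:E * PC z (coupled z j k `&` high z (k + M)) +
  (L `^ (eta - 1))%:E * ((R0 + K)%:E * PC z (coupled z j j)).
Proof.
move=> jk L0; have mX := @measurable_cp_H z (k + M).
set A := _ `&` _; have mA : measurable A by exact: measurableI.
have mX' : measurable_fun setT (fun w => (cp_H T H (C z) (k + M) w)%:E).
  exact: measurableT_comp.
have Lp : (0 <= L `^ (eta - 1))%R by rewrite powR_ge0.
apply: (@le_trans _ _ (\int[PC z]_(w in A) ((L `^ eta)%:E +
    (L `^ (eta - 1))%:E * (cp_H T H (C z) (k + M) w)%:E))).
  apply: ge0_le_integral => //.
  - by move=> w _; rewrite lee_fin powR_ge0.
  - apply: measurable_funTS; apply: measurableT_comp => //.
    exact: (measurableT_comp (@measurable_powR R eta) mX).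
  - apply: measurable_funTS; apply: emeasurable_funD => //.
    exact: measurable_funeM.
  - by move=> w _; rewrite -EFinM -EFinD lee_fin; exact: powR_le_add.
rewrite ge0_integralD//; last 3 first.
- by move=> w _; rewrite lee_fin powR_ge0.
- by move=> w _; rewrite mule_ge0 ?lee_fin.
- by apply: measurable_funTS; exact: measurable_funeM.
rewrite integral_cstE// leeD2l// ge0_integralZl_EFin//; last 2 first.
- by move=> w _; rewrite lee_fin.
- exact: measurable_funTS.
apply: lee_wpmul2l; first by rewrite lee_fin.
(* The mean of H is controlled only from a restart time, so the failing event is enlarged to the
   start of the attempt at time j, an event of F_{jT}. *)
apply: (@le_trans _ _ (\int[PC z]_(w in coupled z j j)
    (cp_H T H (C z) (k + M) w)%:E)).
  apply: ge0_subset_integral => //; first exact: measurable_funTS.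
    by move=> w _; rewrite lee_fin.
  by move=> w [l0w _]; apply: (coupled_sub _ l0w); rewrite leqnn.
rewrite -(subnKC (leq_trans jk (leq_addr M k))).
exact: restart_low (@coupled_restart z j) (@filtration_coupled z j j) _.
Qed.


Let high_split z k M : high z (k + M) `<=`
  high z k `|` ((coupled z k k `|` low z k) `|`
    \big[setU/set0]_(j < k) (coupled z j k `&` high z (k + M))).
Proof.
move=> w hw; have [l0N|[j jk l0j]] := @l0_range z k w.
  have [H_le|H_gt] := leP (cp_H T H (C z) k w) R0; last by left.
  by right; left; right.
move: jk; rewrite leq_eqVlt => /orP[/eqP jk|jk].
  by right; left; left; rewrite /coupled/= l0j jk.
right; right; rewrite -(bigcup_mkord k (fun j => coupled z j k `&` high z (k + M))).
by exists j.
Qed.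

Let integral_bigsetU_le z (f : cp_space (C z) -> \bar R) n
    (A : nat -> set (cp_space (C z))) :
  (forall j, measurable (A j)) -> measurable_fun setT f ->
  (forall w, 0 <= f w) ->
  \int[PC z]_(w in \big[setU/set0]_(j < n) A j) f w <=
  \sum_(j < n) \int[PC z]_(w in A j) f w.
Proof.
move=> mA mf f0; elim: n => [|n IH].
  by rewrite !big_ord0 integral_set0.
rewrite !big_ord_recr/=; apply: le_trans (leeD2r _ IH).
have mU : measurable (\big[setU/set0]_(j < n) A j) by exact: bigsetU_measurable.
by apply: ge0_integral_setU_le => //; exact: measurableU.
Qed.

Let prob z (A : set (cp_space (C z))) : R := fine (PC z A).

Let probE z A : measurable A -> (@prob z A)%:E = PC z A.
Proof. by move=> mA; rewrite /prob fineK// fin_num_measure. Qed.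

Let prob_ge0 z A : (0 <= @prob z A)%R.
Proof. exact: fine_ge0. Qed.

Let prob_le z A B : measurable A -> measurable B -> A `<=` B ->
  (@prob z A <= prob B)%R.
Proof. by move=> mA mB AB; rewrite -lee_fin !probE// le_measure ?inE. Qed.

Let prob_setU z A B : measurable A -> measurable B -> A `&` B = set0 ->
  (@prob z (A `|` B) = prob A + prob B)%R.
Proof.
move=> mA mB AB; apply: EFin_inj; rewrite EFinD !probE ?measureU//.
exact: measurableU.
Qed.

Let prob_coupled_lt z k n : (prob (\big[setU/set0]_(j < n) coupled z j k) =
  \sum_(j < n) prob (coupled z j k))%R.
Proof.
elim: n => [|n IH]; first by rewrite !big_ord0 /prob measure0.
rewrite !big_ord_recr/= prob_setU ?IH//; first exact: bigsetU_measurable.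
rewrite -(bigcup_mkord n (fun j => coupled z j k)) -subset0.
move=> w [[j /= jn] + l0n]; rewrite /coupled/= l0n => -[nj].
by move: jn; rewrite nj ltnn.
Qed.

(** Makes the moments finite, hence real sequences, and supplies their first M values. *)
Let moment_fin z k : \int[PC z]_(w in high z k) (cp_H T H (C z) k w `^ eta)%:E <=
  (1 + (Hs z + K))%:E.
Proof.
have mX := @measurable_cp_H z k.
have mXe : measurable_fun setT (fun w => (cp_H T H (C z) k w `^ eta)%:E).
  by apply: measurableT_comp => //; exact: (measurableT_comp (@measurable_powR R eta) mX).
apply: (@le_trans _ _ (\int[PC z]_w (cp_H T H (C z) k w `^ eta)%:E)).
  apply: ge0_subset_integral => //.
  by move=> w _; rewrite lee_fin powR_ge0.
apply: (@le_trans _ _ (\int[PC z]_w (1 + (cp_H T H (C z) k w)%:E))).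
  apply: ge0_le_integral => //.
  - by move=> w _; rewrite lee_fin powR_ge0.
  - by apply: emeasurable_funD => //; exact: measurableT_comp.
  - by move=> w _; rewrite -EFinD lee_fin; exact: powR_le1D.
rewrite ge0_integralD//; last 2 first.
- by move=> w _; rewrite lee_fin cp_H_ge0.
- exact: measurableT_comp.
rewrite EFinD; apply: leeD; last exact: lyapunov_le (time_set_mul k).
by rewrite integral_cstE// mul1e; exact: probability_le1.
Qed.

Variables (p : nat -> R) (c pm1 : R).
Hypotheses (c_ge0 : (0 <= c)%R) (pm1_gt0 : (0 < pm1)%R).
Hypothesis p_gt0 : forall k, (0 < p k)%R.
Hypothesis p_rate : forall k, (1 - p k <= c * decay (1 + q) k)%R.
Hypothesis l0_stay : forall z (l k : nat), (l <= k)%N ->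
  0 < PC z [set w | cp_l0 (C z) k w = Some l] ->
  (p (k - l)%N <= cond_pr (PC z)
    [set w | cp_l0 (C z) k.+1 w = Some l]
    [set w | cp_l0 (C z) k w = Some l])%R.
Hypothesis l0_try : forall z k,
  0 < PC z [set w | cp_l0 (C z) k w = None /\ (cp_H T H (C z) k w <= R0)%R] ->
  (pm1 <= cond_pr (PC z)
    [set w | cp_l0 (C z) k.+1 w = Some k.+1]
    [set w | cp_l0 (C z) k w = None /\ (cp_H T H (C z) k w <= R0)%R])%R.

(** The product form also covers a null conditioning event, about which the conditional bound says
    nothing. *)
Let cond_pr_le z (A B : set (cp_space (C z))) r : measurable A -> measurable B ->
  (0 < PC z B -> (r <= cond_pr (PC z) A B)%R) ->
  (r * prob B <= prob (A `&` B))%R.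
Proof.
move=> mA mB h; have := prob_ge0 B; rewrite le_eqVlt => /orP[/eqP B0|B0].
  by rewrite -B0 mulr0 prob_ge0.
rewrite -ler_pdivlMr//; apply: h.
by rewrite -probE// lte_fin.
Qed.

Let coupled_survives z j : survives p (fun i => prob (coupled z j (j + i)%N)).
Proof.
split => k; first exact: prob_ge0.
  rewrite addnS; apply: prob_le => //; apply: coupled_sub.
  by rewrite leq_addr leqnSn.
have := @cond_pr_le z _ _ (p k) (measurable_coupled z j (j + k).+1)
  (measurable_coupled z j (j + k)).
rewrite addnS => /(_ _)/le_trans; apply; last first.
  by apply: prob_le; [exact: measurableI|exact: measurable_coupled|move=> w []].
by move=> h; have := l0_stay (leq_addr k j) h; rewrite addKn.
Qed.

Lemma l0_tail : exists2 A : R, (0 < A)%R & forall z n N, (n <= N)%N ->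
  PC z (~` [set w | exists2 j, (j < n)%N & cp_l0 (C z) N w = Some j]) <=
  (A * (1 + H z.1.1 + H z.2.1) * decay q n)%:E.
Proof.
have [M M0 hM] := contraction_time.
pose rho : R := (2^-1 `^ eta)%R.
have rho01 : (0 < rho < 1)%R.
  have /andP[e0 e1] := eta01.
  rewrite powR_gt0 ?invr_gt0//=.
  have := @gt0_ltr_powR R eta e0 2^-1%R 1%R; rewrite !nnegrE invr_ge0 powR1.
  by apply=> //; rewrite invf_lt1// ltr1n.
(* One constant for four uses: Markov's inequality at level R0, the initial moments, the restarts
   below R0, and the failures over a window of M steps. *)
pose A : R := ((R0 `^ eta)^-1 + (2 + K) + (1 + (R0 + K)) + (c * M%:R + (R0 + K)))%R.
have K_R0 : (0 <= R0 + K)%R by rewrite addr_ge0// ltW.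
have A1 : (0 <= (R0 `^ eta)^-1)%R by rewrite invr_ge0 powR_ge0.
have A2 : (0 <= 2 + K)%R by rewrite addr_ge0.
have A3 : (0 <= 1 + (R0 + K))%R by rewrite addr_ge0.
have A4 : (0 <= c * M%:R + (R0 + K))%R by rewrite addr_ge0// mulr_ge0.
have A0 : (0 <= A)%R by exact: addr_ge0 (addr_ge0 (addr_ge0 A1 A2) A3) A4.
have [A1A A2A A3A A4A] : [/\ ((R0 `^ eta)^-1 <= A)%R, (2 + K <= A)%R,
    (1 + (R0 + K) <= A)%R & (c * M%:R + (R0 + K) <= A)%R].
  exact: le_sum4.
have [B B0 hB] := coupling_scheme_decay q_gt0 c_ge0 A0 pm1_gt0 rho01 M0 p_gt0 p_rate.
exists B => // z n N nN.
pose s j k := prob (coupled z j k).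
pose l k := prob (low z k).
pose x k := prob (high z k).
pose y k := fine (\int[PC z]_(w in high z k) (cp_H T H (C z) k w `^ eta)%:E).
have yE k : (y k)%:E = \int[PC z]_(w in high z k) (cp_H T H (C z) k w `^ eta)%:E.
  rewrite /y fineK// ge0_fin_numE; last first.
    by apply: integral_ge0 => w _; rewrite lee_fin powR_ge0.
  exact: le_lt_trans (moment_fin z k) (ltry _).
pose h : R := (1 + H z.1.1 + H z.2.1)%R.
have hE : h = (1 + Hs z)%R by rewrite /h addrA.
have h1 : (1 <= h)%R by rewrite hE lerDl Hs_ge0.
have main : (1 - \sum_(j < n) s j N <= B * h * decay q n)%R.
  apply: (hB h s l x y) => //.
  - exact: coupled_survives.
  - by move=> k; exact: prob_ge0.
  - by move=> k; exact: prob_ge0.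
  - move=> k; rewrite -prob_coupled_lt -prob_setU//; last first.
      rewrite -subset0 => w [[_ /= H1] [_ /= H2]].
      by move: H1; rewrite leNgt H2.
    rewrite -prob_setU; last first.
    + rewrite -(bigcup_mkord k.+1 (fun j => coupled z j k)) -subset0.
      by move=> w [[j _ l0j] [[l0N _]|[l0N _]]]; move: l0j; rewrite /coupled/= l0N.
    + exact: measurableU.
    + exact: bigsetU_measurable.
    rewrite (_ : _ `|` _ = setT) /prob ?probability_setT//.
    rewrite -subTset -(bigcup_mkord k.+1 (fun j => coupled z j k)) => w _.
    have [l0N|[j jk l0j]] := @l0_range z k w; last by left; exists j.
    by right; have [Hl|Hg] := leP (cp_H T H (C z) k w) R0; [left|right].
  - move=> k.
    have := @cond_pr_le z _ _ pm1 (measurable_coupled z k.+1 k.+1) (measurable_low z k).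
    move=> /(_ (@l0_try z k))/le_trans; apply.
    by apply: prob_le; [exact: measurableI|exact: measurable_coupled|move=> w []].
  - move=> k; have y0 : (0 <= y k)%R.
      by rewrite -lee_fin yE; apply: integral_ge0 => w _; rewrite lee_fin powR_ge0.
    apply: (@le_trans _ _ ((R0 `^ eta)^-1 * y k)%R); last first.
      exact: ler_wpM2r.
    rewrite mulrC ler_pdivlMr ?powR_gt0// mulrC -lee_fin EFinM yE probE//.
    rewrite -integral_cstE//; apply: ge0_le_integral => //.
    + by move=> w _; rewrite lee_fin powR_ge0.
    + apply: measurable_funTS; apply: measurableT_comp => //.
      exact: (measurableT_comp (@measurable_powR R eta) (@measurable_cp_H z k)).
    + move=> w [_ /= Hw]; rewrite lee_fin.
      have /andP[e0 _] := eta01.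
      by apply: ge0_ler_powR; rewrite ?nnegrE ?cp_H_ge0//; exact: ltW.
  - move=> k _; rewrite -lee_fin yE; apply: le_trans (moment_fin z k) _.
    rewrite lee_fin addrA -hE; apply: (@le_trans _ _ ((2 + K) * h)%R).
      rewrite mulrDl lerD//; last by rewrite ler_peMr.
      by rewrite ler_peMl ?ler1n// (le_trans _ h1).
    by rewrite ler_wpM2r// (le_trans _ h1).
  - move=> k; rewrite -lee_fin yE EFinD EFinD !EFinM yE.
    have mXe : measurable_fun setT
        (fun w => (cp_H T H (C z) (k + M) w `^ eta)%:E).
      apply: measurableT_comp => //.
      exact: (measurableT_comp (@measurable_powR R eta) (@measurable_cp_H z (k + M))).
    have Xe0 w : 0 <= (cp_H T H (C z) (k + M) w `^ eta)%:E.
      by rewrite lee_fin powR_ge0.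
    pose D := \big[setU/set0]_(j < k) (coupled z j k `&` high z (k + M)).
    have mD : measurable D.
      by apply: bigsetU_measurable => j _; exact: measurableI.
    have mGL : measurable (coupled z k k `|` low z k) by exact: measurableU.
    have mU : measurable ((coupled z k k `|` low z k) `|` D) by exact: measurableU.
    have := @ge0_integral_setU_le _ _ _ (PC z) _ _ _ _
      (measurable_high z (k + M)) (measurable_high z k) mU mXe Xe0
      (@high_split z k M).
    move=> /le_trans; apply; rewrite -addeA; apply: leeD.
      exact: high_step.
    have := @ge0_integral_setU_le _ _ _ (PC z) _ _ _ _
      mU mGL mD mXe Xe0 (@subset_refl _ _).
    move=> /le_trans; apply; apply: leeD.
      have := @ge0_integral_setU_le _ _ _ (PC z) _ _ _ _
        mGL (measurable_coupled z k k) (measurable_low z k) mXe Xe0 (@subset_refl _ _).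
      move=> /le_trans; apply.
      apply: (@le_trans _ _ ((1 + (R0 + K))%:E * (s k k + l k)%:E)); last first.
        rewrite -EFinM -EFinM lee_fin ler_wpM2r//.
        exact: addr_ge0 (prob_ge0 _) (prob_ge0 _).
      rewrite [(s k k + _)%:E]EFinD ge0_muleDr ?lee_fin ?prob_ge0// /s /l !probE//.
      apply: leeD; first exact: restart_low_powR (@coupled_restart z k) _ _.
      apply: restart_low_powR; last exact: filtration_low.
      by move=> w [l0N Hw]; split => //; right.
    have := @integral_bigsetU_le z _ k
      (fun j => coupled z j k `&` high z (k + M)) _ mXe Xe0.
    move=> /(_ (fun j => measurableI _ _ (measurable_coupled z j k) (measurable_high z (k + M)))).
    move=> /le_trans; apply.
    rewrite -EFinM mulr_sumr -sumEFin; apply: lee_sum => j _.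
    have jk : (j <= k)%N by exact: ltnW.
    pose m := (k - j)%N.
    have L0 : (0 < (m.+1%:R : R) `^ (1 + q))%R by rewrite powR_gt0.
    apply: le_trans (failure_step z M jk L0) _.
    have Leta : ((m.+1%:R `^ (1 + q)) `^ eta = m.+1%:R :> R)%R.
      by rewrite -powRrM /eta divff ?gt_eqF ?addr_gt0// powRr1.
    have Leta1 : ((m.+1%:R `^ (1 + q)) `^ (eta - 1) = decay q m :> R)%R.
      rewrite -powRrM mulrBr /eta divff ?gt_eqF ?addr_gt0// mulr1 opprD addrA.
      by rewrite subrr sub0r.
    have mA : measurable (coupled z j k `&` high z (k + M)) by exact: measurableI.
    (* Having l_0 = infinity at k + M excludes being still in attempt j, so this event is part of
       the loss of the attempt over the window. *)
    have PA : (prob (coupled z j k `&` high z (k + M)) <=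
        c * M%:R * decay (1 + q) m * s j j)%R.
      have := survives_window q_gt0 c_ge0 p_rate m M (@coupled_survives z j).
      rewrite addn0 addnA subnKC// => /(le_trans _); apply.
      rewrite lerBrDr -prob_setU//; last first.
        by rewrite -subset0 => w [[_ [/= l0N _]]]; rewrite /coupled/= l0N.
      apply: prob_le => //; first exact: measurableU.
      by move=> w [[]//|]; apply: coupled_sub; rewrite jk leq_addr.
    rewrite Leta Leta1 -!probE// -!EFinM -EFinD lee_fin.
    apply: (@le_trans _ _ ((c * M%:R + (R0 + K)) * (s j j * decay q m))%R); last first.
      by rewrite ler_wpM2r// mulr_ge0 ?decay_ge0// prob_ge0.
    rewrite [leRHS]mulrDl lerD//; last by rewrite mulrC -mulrA.
    apply: le_trans (ler_wpM2l (ler0n _ _) PA) _.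
    rewrite decayD [decay 1 m]powR_inv1// le_eqVlt; apply/orP; left; apply/eqP.
    have : (m.+1%:R != 0 :> R)%R by rewrite pnatr_eq0.
    by move: (m.+1%:R : R)%R => a a0; field.
have -> : [set w | exists2 j, (j < n)%N & cp_l0 (C z) N w = Some j] =
    \big[setU/set0]_(j < n) coupled z j N.
  by rewrite -(bigcup_mkord n (fun j => coupled z j N)).
have mU : measurable (\big[setU/set0]_(j < n) coupled z j N).
  exact: bigsetU_measurable.
by rewrite probability_setC// -probE// -EFinB lee_fin prob_coupled_lt.
Qed.

End coupling_time.
(** * Expectations of Lipschitz functions *)

Section polish.
Context {R : realType} {dE : measure_display} {E : polishType dE R}.

Lemma lipschitz_measurable (phi : E -> R) (L : R) :
  (forall x y, `|phi x - phi y| <= L * mdist x y) -> measurable_fun setT phi.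
Proof.
move=> Lphi.
apply: (measurability _ (RGenOInfty.measurableE R)) => //.
move=> _ [_ [a ->] <-]; rewrite setTI polish_borel.
apply: sub_sigma_algebra; rewrite openE => x /=.
rewrite in_itv/= andbT => ax; apply/nbhs_ballP.
have L0 : 0 < `|L| + 1 by rewrite ltr_wpDl.
exists ((phi x - a) / (`|L| + 1)); first by rewrite /= divr_gt0// subr_gt0.
move=> y; rewrite ballEmdist/= ltr_pdivlMr// => xy; rewrite in_itv/= andbT.
have := Lphi x y; rewrite ler_norml => /andP[_ Lxy].
have : L * mdist x y <= mdist x y * (`|L| + 1).
  rewrite mulrC ler_wpM2l ?mdist_ge0//.
  by apply: le_trans (ler_norm _) _; rewrite lerDl.
move: (_ * _) (_ * _) (phi x) (phi y) xy Lxy => u v s t; lra.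
Qed.

Lemma mdist_lipschitz (a x y : E) : `|mdist a x - mdist a y| <= 1 * mdist x y.
Proof.
have h1 := metric_triangle a x y; have h2 := metric_triangle a y x.
rewrite (metric_sym y x) in h2.
by rewrite mul1r ler_norml; apply/andP; split; lra.
Qed.

Lemma measurable_mdist d (Om : measurableType d) (X Y : Om -> E) :
  measurable_fun setT X -> measurable_fun setT Y ->
  measurable_fun setT (fun w => mdist (X w) (Y w)).
Proof.
move=> mX mY; have [D Dcnt Dd] := @polish_separable dE R E.
have md a : measurable_fun setT (fun w => mdist a (X w) + mdist a (Y w)).
  have ma : measurable_fun setT (@mdist R E a).
    exact: lipschitz_measurable (mdist_lipschitz a).
  by apply: measurable_funD; [exact: (measurableT_comp ma mX)|
                              exact: (measurableT_comp ma mY)].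
apply: (measurability _ (RGenInftyO.measurableE R)) => //.
move=> _ [_ [c ->] <-]; rewrite setTI.
(* Separability makes mdist measurable for the product sigma-algebra. *)
have -> : (fun w => mdist (X w) (Y w)) @^-1` `]-oo, c[%classic =
    \bigcup_(a in D) [set w | mdist a (X w) + mdist a (Y w) < c].
  apply/seteqP; split => w /=.
    rewrite in_itv/= => XYc; pose e := (c - mdist (X w) (Y w)) / 2.
    have e0 : 0 < e by rewrite divr_gt0// subr_gt0.
    have Xint : (ball (X w) e)° (X w).
      exact: nbhs_singleton (nbhs_interior (nbhsx_ballx (X w) e e0)).
    have [a [/= aX Da]] :=
      Dd (ball (X w) e)° (ex_intro _ _ Xint) (open_interior _).
    exists a => //=; have := interior_subset aX; rewrite ballEmdist/= => Xa.
    have h1 := metric_triangle a (X w) (Y w).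
    rewrite (metric_sym a (X w)) in h1 *.
    apply: (@le_lt_trans _ _ (mdist (X w) a + (mdist (X w) a + mdist (X w) (Y w)))).
      by rewrite lerD2l.
    move: Xa; rewrite /e ltr_pdivlMr//; lra.
  move=> [a _ /=]; rewrite in_itv/=; apply: le_lt_trans.
  by rewrite (metric_sym a); exact: metric_triangle.
have /pfcard_geP[->|[f]] := Dcnt; first by rewrite bigcup_set0.
have -> : \bigcup_(a in D) [set w | mdist a (X w) + mdist a (Y w) < c] =
    \bigcup_n [set w | mdist (f n) (X w) + mdist (f n) (Y w) < c].
  apply/seteqP; split => w [].
    by move=> a /(surj (f := f))[n _ <-] h; exists n.
  by move=> n _ h; exists (f n) => //; exact: funS.
apply: bigcupT_measurable => n.
by rewrite -[X in measurable X]setTI; apply: measurable_fun_ltr.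
Qed.

Lemma sup_norm_ge (phi : E -> R) x : lip_b phi -> `|phi x| <= sup_norm phi.
Proof.
move=> [[M hM] _]; apply: ub_le_sup; last by exists x.
by exists M => _ [y _ <-].
Qed.

Lemma lip_const_ge (phi : E -> R) x y : lip_b phi ->
  `|phi x - phi y| <= lip_const phi * mdist x y.
Proof.
move=> [_ [L hL]]; have [->|xy] := eqVneq x y.
  by rewrite subrr normr0 mdistxx mulr0.
rewrite -ler_pdivrMr ?mdist_gt0//; apply: ub_le_sup; last by exists (x, y).
exists L => _ [[a b]/= ab <-].
by rewrite ler_pdivrMr ?mdist_gt0.
Qed.

Lemma lip_const_ge0 (phi : E -> R) : lip_b phi -> 0 <= lip_const phi.
Proof.
move=> [_ [L hL]]; rewrite /lip_const.
(* The set is empty when E has a single point, and [sup] is then 0 by convention. *)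
set S := (X in sup X); have [->|/set0P[r Sr]] := eqVneq S set0.
  by rewrite sup0.
have r0 : 0 <= r by case: Sr => -[a b]/= _ <-; rewrite divr_ge0// mdist_ge0.
apply: le_trans r0 _; apply: ub_le_sup => //.
exists L => _ [[a b]/= ab <-].
by rewrite ler_pdivrMr ?mdist_gt0.
Qed.

End polish.
(** The coupling inequality: on a common space the gap is one integral, bounded by the Lipschitz
    constant off B and by twice the sup norm on B. *)
Lemma expectation_gap_le (R : realType) dE (E : polishType dE R) d
    (Om : measurableType d) (Q : probability Om R) (X Y : Om -> E)
    (phi : E -> R) (dl : R) (B : set Om) :
  measurable_fun setT X -> measurable_fun setT Y -> measurable B -> lip_b phi ->
  0 <= dl -> (forall w, ~ B w -> mdist (X w) (Y w) <= dl) ->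
  (`|\int[Q]_w (phi (X w))%:E - \int[Q]_w (phi (Y w))%:E| <=
   (lip_const phi * dl)%:E + (2 * sup_norm phi)%:E * Q B)%E.
Proof.
move=> mX mY mB lphi dl0 XY.
have [_ [L hL]] := lphi.
have mphi := lipschitz_measurable hL.
have S0 : 0 <= sup_norm phi by apply: le_trans (sup_norm_ge point lphi).
have L0 := lip_const_ge0 lphi.
have intphi (Z : Om -> E) : measurable_fun setT Z ->
    Q.-integrable setT (EFin \o (phi \o Z)).
  move=> mZ; apply: measurable_bounded_integrable => //.
  - exact: le_lt_trans (probability_le1 Q measurableT) (ltry _).
  - exact: (measurableT_comp mphi mZ).
  - exists (sup_norm phi); split; first exact: num_real.
    by move=> M hM w _ /=; apply: le_trans (ltW hM); exact: sup_norm_ge.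
rewrite -(integralB_EFin _ (intphi X mX) (intphi Y mY))//.
have mg : measurable_fun setT (fun w => phi (X w) - phi (Y w)).
  by apply: measurable_funB; [exact: (measurableT_comp mphi mX)|
                              exact: (measurableT_comp mphi mY)].
apply: le_trans (le_abse_integral _ _ _) _ => //; first exact: measurableT_comp.
apply: (@le_trans _ _ (\int[Q]_w ((lip_const phi * dl)%:E +
    (2 * sup_norm phi)%:E * (\1_B w)%:E))%E).
  apply: ge0_le_integral => //.
  - have mgE : measurable_fun setT (fun w => (phi (X w) - phi (Y w))%:E).
      exact: measurableT_comp.
    exact: (measurableT_comp _ mgE).
  - apply: emeasurable_funD => //; apply: measurable_funeM.
    by apply: measurableT_comp.
  - move=> w _; rewrite -EFinB -EFinM -EFinD/= lee_fin.
    have [Bw|nBw] := pselect (B w).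
      rewrite indicE mem_set// mulr1 -[leLHS]add0r lerD ?mulr_ge0//.
      apply: le_trans (ler_normB _ _) _; rewrite mulr_natl mulr2n.
      by rewrite lerD// sup_norm_ge.
    rewrite indicE memNset// mulr0 addr0.
    by apply: le_trans (lip_const_ge _ _ lphi) _; rewrite ler_wpM2l// XY.
rewrite ge0_integralD//; last 3 first.
- by move=> w _; rewrite lee_fin mulr_ge0.
- by move=> w _; rewrite -EFinM lee_fin !mulr_ge0.
- by apply: measurable_funeM; exact: measurableT_comp.
apply: leeD.
  rewrite integral_cst// -[leRHS]mule1 lee_wpmul2l ?lee_fin ?mulr_ge0//.
  exact: probability_le1.
rewrite ge0_integralZl_EFin ?mulr_ge0//; last exact: measurableT_comp.
by rewrite integral_indic// setIT.
Qed.

Theorem theorem2p9 (R : realType) (dE dF dO : measure_display)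
  (E : polishType dE R) (F : polishType dF R)
  (T : R) (T_gt0 : 0 < T) (I : set R) (I_time : time_set T I)
  (Om : measurableType dO) (P : probability Om R)
  (u : E -> R -> Om -> E) (W : F -> R -> Om -> F)
  (u_markov : strong_markov I P u) (W_markov : strong_markov I P W)
  (H : E -> R) (H_ge0 : forall x, 0 <= H x) (H_meas : measurable_fun setT H)
  (C : (E * F) * (E * F) -> coupled_process R (E * F)%type)
  (C_coupling : forall z,
    is_coupling I P (fun t w => (u z.1.1 t w, W z.1.2 t w))
                    (fun t w => (u z.2.1 t w, W z.2.2 t w)) (C z))
  (C_markov : l0_markov T I C)
  (d0 : R) (d0_gt0 : 0 < d0)
  (cond_i_back : forall z (l k : nat) w, (l <= k)%N ->
    cp_l0 (C z) k.+1 w = Some l -> cp_l0 (C z) k w = Some l)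
  (cond_i_range : forall z k w, cp_l0 (C z) k w = None \/
    exists2 l, (l <= k)%N & cp_l0 (C z) k w = Some l)
  (cond_i_adapted : forall z k (a : option nat),
    filtration_of I (cp_pair (C z)) (k%:R * T) [set w | cp_l0 (C z) k w = a])
  (cond_i_start : forall z k w, cp_l0 (C z) k w = Some k ->
    cp_H T H (C z) k w <= d0)
  (c0 q : R) (c0_gt0 : 0 < c0) (q_gt0 : 0 < q)
  (cond_ii : forall z (l k : nat) t, (l <= k)%N -> I t ->
    l%:R * T <= t <= k%:R * T ->
    (cp_prob (C z)
       [set w | c0%:E * neg_power (t - l%:R * T) q
                < (mdist (cp_u1 (C z) t w) (cp_u2 (C z) t w))%:E /\
                natinf_le (cp_l0 (C z) k w) l]
     <= c0%:E * neg_power (t - l%:R * T) q)%E)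
  (p : nat -> R) (c1 q0 : R) (c1_gt0 : 0 < c1) (q0_gt : 1 + q < q0)
  (cond_iii : forall z (l k : nat), (l <= k)%N ->
    (0 < cp_prob (C z) [set w | cp_l0 (C z) k w = Some l])%E ->
    p (k - l)%N <= cond_pr (cp_prob (C z))
      [set w | cp_l0 (C z) k.+1 w = Some l]
      [set w | cp_l0 (C z) k w = Some l])
  (cond_iii_rate : forall k, 1 - p k <= c1 * (k.+1%:R * T) `^ (- q0))
  (cond_iii_pos : forall k, 0 < p k)
  (pm1 R0 : R) (pm1_gt0 : 0 < pm1) (R0_gt0 : 0 < R0)
  (cond_iv : forall z k,
    (0 < cp_prob (C z)
      [set w | cp_l0 (C z) k w = None /\ (cp_H T H (C z) k w <= R0)%R])%E ->
    pm1 <= cond_pr (cp_prob (C z))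
      [set w | cp_l0 (C z) k.+1 w = Some k.+1]
      [set w | cp_l0 (C z) k w = None /\ cp_H T H (C z) k w <= R0])
  (alpha K1 K' : R) (alpha_gt0 : 0 < alpha)
  (cond_v_lyapunov : forall x t, I t ->
    ('E_P[fun w => H (u x t w)]
     <= (expR (- alpha * t) * H x + K1 / 2)%:E)%E)
  (cond_v_stopped : forall z (tau : cp_space (C z) -> \bar R),
    stopping_time I (filtration_of I (cp_pair (C z))) tau ->
    (forall w, tau w = +oo%E \/ exists k : nat, tau w = (k%:R * T)%:E) ->
    (stopped_mean (cp_prob (C z)) (fun t w => H (cp_u1 (C z) t w)) tau
       <= K'%:E *
          ((H z.1.1)%:E + stopped_mean (cp_prob (C z)) (fun t _ => t) tau))%E /\
    (stopped_mean (cp_prob (C z)) (fun t w => H (cp_u2 (C z) t w)) tau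
       <= K'%:E *
          ((H z.2.1)%:E + stopped_mean (cp_prob (C z)) (fun t _ => t) tau))%E)
  (R0_gt : 4 * K1 < R0) (R0_ge : d0 <= R0) :
  exists2 c4 : R, 0 < c4 &
    forall (phi : E -> R), lip_b phi -> forall (x1 x2 : E) (t : R), I t ->
      (`| 'E_P[fun w => phi (u x1 t w)] - 'E_P[fun w => phi (u x2 t w)] |
       <= (c4 * (1 + t) `^ (- q) * lip_norm phi * (1 + H x1 + H x2))%:E)%E.
Proof.
have [u_meas _ _ _] := u_markov; have [W_meas _ _ _] := W_markov.
(* Rescales (iii) from ((k+1)T)^{-q0} to (k+1)^{-1-q}, giving up the excess of q0 over 1 + q. *)
pose c := c1 * T `^ (- q0).
have c_ge0 : 0 <= c by rewrite mulr_ge0 ?powR_ge0// ltW.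
have p_rate k : 1 - p k <= c * decay (1 + q) k.
  apply: le_trans (cond_iii_rate k) _.
  rewrite powRM ?(ltW T_gt0)// /c -mulrA ler_pM2l// mulrC.
  by rewrite ler_pM2l ?powR_gt0// decay_leq// ltW.
have [A A0 tail] := l0_tail T_gt0 I_time u_meas W_meas C_coupling H_ge0 H_meas
  cond_v_lyapunov C_markov cond_i_back cond_i_range cond_i_adapted cond_i_start
  R0_ge R0_gt0 R0_gt alpha_gt0 q_gt0 c_ge0 pm1_gt0 cond_iii_pos p_rate
  cond_iii cond_iv.
(* For t >= 1 one has 1 + t <= 4 (t - lT) and 1 + t <= 4T (l + 2), whence the two terms; the term 2
   * 2^q added in [c4] handles t < 1. *)
pose D := c0 * 4 `^ q + A * (4 * T) `^ q.
have D0 : 0 < D by rewrite addr_gt0// mulr_gt0// powR_gt0// mulr_gt0.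
pose c4 := 2 * D + 2 * 2 `^ q.
exists c4; first by rewrite addr_gt0// mulr_gt0// powR_gt0.
move=> phi lphi x1 x2 t It; rewrite unlock.
have t0 := time_set_ge0 T_gt0 I_time It.
(* The conclusion concerns u alone, so any starting value of W will do. *)
pose z : (E * F) * (E * F) := ((x1, point), (x2, point)).
have [_ [L hL]] := lphi.
have mphi := lipschitz_measurable hL.
have S0 : 0 <= sup_norm phi by apply: le_trans (sup_norm_ge point lphi).
have L0 := lip_const_ge0 lphi.
have mV := coupling_measurable C_coupling (z := z).
have mu1 s : I s -> measurable_fun setT (cp_u1 (C z) s).
  move=> Is; exact: (measurableT_comp (@measurable_fst _ _ _ _)
    (measurableT_comp (@measurable_fst _ _ _ _) (mV _ Is))).
have mu2 s : I s -> measurable_fun setT (cp_u2 (C z) s).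
  move=> Is; exact: (measurableT_comp (@measurable_fst _ _ _ _)
    (measurableT_comp (@measurable_snd _ _ _ _) (mV _ Is))).
have mf : measurable_fun setT (fun v : E * F => (phi v.1)%:E).
  by apply: measurableT_comp => //; exact: (measurableT_comp mphi (@measurable_fst _ _ _ _)).
have e1 : (\int[P]_w (phi (u x1 t w))%:E =
    \int[cp_prob (C z)]_w (phi (cp_u1 (C z) t w))%:E)%E.
  (* The transfer to the coupling holds for nonnegative functions, hence the positive and negative
     parts. *)
  rewrite integralE [RHS]integralE; congr (_ - _)%E.
    transitivity (\int[P]_w (fun v : E * F => (phi v.1)%:E)^\+ (u x1 t w, W point t w))%E.
      by apply: eq_integral => w _; rewrite !funeposE.
    rewrite -(coupling_integral1 u_meas W_meas C_coupling z It (measurable_funepos mf)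
      (fun v => funepos_ge0 _ v)).
    by apply: eq_integral => w _; rewrite !funeposE.
  transitivity (\int[P]_w (fun v : E * F => (phi v.1)%:E)^\- (u x1 t w, W point t w))%E.
    by apply: eq_integral => w _; rewrite !funenegE.
  rewrite -(coupling_integral1 u_meas W_meas C_coupling z It (measurable_funeneg mf)
    (fun v => funeneg_ge0 _ v)).
  by apply: eq_integral => w _; rewrite !funenegE.
have e2 : (\int[P]_w (phi (u x2 t w))%:E =
    \int[cp_prob (C z)]_w (phi (cp_u2 (C z) t w))%:E)%E.
  rewrite integralE [RHS]integralE; congr (_ - _)%E.
    transitivity (\int[P]_w (fun v : E * F => (phi v.1)%:E)^\+ (u x2 t w, W point t w))%E.
      by apply: eq_integral => w _; rewrite !funeposE.
    rewrite -(coupling_integral2 u_meas W_meas C_coupling z It (measurable_funepos mf)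
      (fun v => funepos_ge0 _ v)).
    by apply: eq_integral => w _; rewrite !funeposE.
  transitivity (\int[P]_w (fun v : E * F => (phi v.1)%:E)^\- (u x2 t w, W point t w))%E.
    by apply: eq_integral => w _; rewrite !funenegE.
  rewrite -(coupling_integral2 u_meas W_meas C_coupling z It (measurable_funeneg mf)
    (fun v => funeneg_ge0 _ v)).
  by apply: eq_integral => w _; rewrite !funenegE.
rewrite e1 e2.
pose h := 1 + H x1 + H x2.
have h1 : 1 <= h by rewrite /h -addrA lerDl addr_ge0.
have h0 : 0 <= h by exact: le_trans h1.
have nrm0 : 0 <= lip_norm phi by rewrite addr_ge0.
have d0' : 0 <= (1 + t) `^ (- q) by exact: powR_ge0.
have [t1|t1] := ltP t 1.
  apply: le_trans (expectation_gap_le _ (mu1 t It) (mu2 t It) measurableT lphi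
    (lexx 0) _) _; first by move=> w [].
  rewrite mulr0 add0e; apply: (@le_trans _ _ (2 * sup_norm phi)%:E).
    rewrite -[leRHS]mule1 lee_wpmul2l ?lee_fin ?mulr_ge0//.
    exact: probability_le1.
  have h2 : 1 <= 2 `^ q * (1 + t) `^ (- q).
    have := @ratio_powR_le R 1 (1 + t) 2 q ltr01 _ _ (ltW q_gt0).
    by rewrite powR1 mulr1 lerD2l; apply=> //; [rewrite ltr_pwDl|exact: ltW].
  rewrite lee_fin.
  have S_N : sup_norm phi <= lip_norm phi by rewrite lerDl.
  apply: (@le_trans _ _ (2 * lip_norm phi)); first by rewrite ler_pM2l.
  apply: (@le_trans _ _ (c4 * (1 + t) `^ (- q) * lip_norm phi)).
    rewrite ler_wpM2r// /c4 mulrDl -[leLHS]add0r lerD//.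
      by rewrite mulr_ge0// mulr_ge0// ltW.
    by rewrite -mulrA ler_peMr.
  by rewrite ler_peMr// mulr_ge0// mulr_ge0// addr_ge0 ?mulr_ge0 ?powR_ge0// ltW.
have tT0 : 0 <= t / T by rewrite divr_ge0// ltW.
have t2T0 : 0 <= t / (2 * T) by rewrite divr_ge0// mulr_ge0// ltW.
(* kT > t makes (ii) applicable at t. With l = floor(t/(2T)), the distance t - lT is at least t/2,
   while l + 1 stays of order t for the tail of l_0. *)
pose k := (Num.truncn (t / T)).+1; pose l := Num.truncn (t / (2 * T)).
have T20 : 0 < 2 * T by rewrite mulr_gt0.
have tk : t <= k%:R * T.
  by have /andP[_ /ltW] := truncn_itv tT0; rewrite ler_pdivrMr.
have lt : l%:R * T <= t / 2.
  have /andP[+ _] := truncn_itv t2T0.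
  by rewrite ler_pdivlMr// mulrCA mulrC -ler_pdivlMr.
have tl : t <= l.+1%:R * (2 * T).
  by have /andP[_ /ltW] := truncn_itv t2T0; rewrite ler_pdivrMr.
have lk : (l < k)%N.
  rewrite -(ltr_nat R) -(ltr_pM2r T_gt0); apply: (@le_lt_trans _ _ (t / 2)) => //.
  apply: lt_le_trans tk; rewrite ltr_pdivrMr//; lra.
pose s := t - l%:R * T.
have s_ge : t / 2 <= s by rewrite /s lerBrDl -lerBrDr; apply: le_trans lt _; lra.
have s0 : 0 < s by apply: lt_le_trans s_ge; lra.
pose dl := c0 * s `^ (- q).
have dl0 : 0 <= dl by rewrite mulr_ge0 ?powR_ge0// ltW.
have npE : (c0%:E * neg_power (t - l%:R * T) q = dl%:E)%E.
  by rewrite /neg_power -/s gt_eqF// -EFinM.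
(* j < l + 1 encodes l_0(k) <= l, so the tail bound is used at n = l + 1, which is at most k because
   l < k. *)
pose good := [set w | exists2 j, (j < l.+1)%N & cp_l0 (C z) k w = Some j].
have mgood : measurable good.
  apply: (@bigcup_measurable _ _ (fun j => [set w | cp_l0 (C z) k w = Some j])) => j _.
  exact: (filtration_measurable (coupling_measurable C_coupling) (cond_i_adapted z k (Some _))).
have goodE w : natinf_le (cp_l0 (C z) k w) l <-> good w.
  rewrite /natinf_le /good/=; case: (cp_l0 (C z) k w) => [j|]; split => //.
  - by move=> jl; exists j.
  - by move=> [j' jl [->]].
  - by move=> [].
pose bad := [set w | dl < mdist (cp_u1 (C z) t w) (cp_u2 (C z) t w)] `&` good.
have mbad : measurable bad.
  apply: measurableI => //; rewrite -[X in measurable X]setTI.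
  apply: measurable_fun_ltr => //; exact: measurable_mdist (mu1 t It) (mu2 t It).
have mB : measurable (bad `|` ~` good) by apply: measurableU => //; exact: measurableC.
apply: le_trans (expectation_gap_le _ (mu1 t It) (mu2 t It) mB lphi dl0 _) _.
  move=> w nB; rewrite leNgt; apply/negP => dlt; apply: nB.
  by have [gw|ngw] := pselect (good w); [left|right].
have Pbad : (cp_prob (C z) bad <= dl%:E)%E.
  rewrite [bad](_ : _ = [set w | (c0%:E * neg_power (t - l%:R * T) q
                < (mdist (cp_u1 (C z) t w) (cp_u2 (C z) t w))%:E)%E /\
                natinf_le (cp_l0 (C z) k w) l]); last first.
    apply/seteqP; split => w /=; rewrite npE lte_fin => -[? ?]; split => //;
      exact/goodE.
  rewrite -npE; apply: cond_ii => //; first exact: ltnW.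
  by rewrite tk andbT; apply: le_trans lt _; lra.
have Pgood := tail z l.+1 k lk.
have PB : (cp_prob (C z) (bad `|` ~` good) <= (dl + A * h * decay q l.+1)%:E)%E.
  apply: le_trans (measureU2 _ _ _) _ => //; first exact: measurableC.
  by rewrite EFinD; apply: leeD.
apply: (@le_trans _ _ ((lip_const phi * dl)%:E + (2 * sup_norm phi)%:E *
    (dl + A * h * decay q l.+1)%:E)%E).
  by apply: leeD => //; apply: lee_wpmul2l => //; rewrite lee_fin mulr_ge0.
rewrite -EFinM -EFinD lee_fin -/h.
have t10 : 0 < 1 + t by rewrite ltr_pwDl.
have dl_le : dl <= c0 * 4 `^ q * (1 + t) `^ (- q).
  rewrite /dl -mulrA ler_pM2l//; apply: ratio_powR_le; rewrite ?(ltW q_gt0)//.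
  by move: s_ge; rewrite -[s]/s; move: (s) => s'; lra.
have dec_le : decay q l.+1 <= (4 * T) `^ q * (1 + t) `^ (- q).
  apply: ratio_powR_le; rewrite ?(ltW q_gt0)// ?mulr_gt0//.
  apply: (@le_trans _ _ (2 * t)); first by move: t1; lra.
  apply: (@le_trans _ _ (2 * (l.+1%:R * (2 * T)))); first by rewrite ler_pM2l.
  rewrite -[l.+2%:R]natr1; move: (l.+1%:R) (ler0n R l.+1) => a a0.
  have : 0 <= a * T by rewrite mulr_ge0// ltW.
  move: T_gt0; clear; nra.
set e := (1 + t) `^ (- q) in dl_le dec_le d0' *.
have tot : dl + A * h * decay q l.+1 <= D * e * h.
  rewrite /D mulrDl mulrDl lerD//.
    by apply: le_trans dl_le _; rewrite ler_peMr// !mulr_ge0 ?powR_ge0// ltW.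
  rewrite -mulrA [h * _]mulrC mulrA ler_wpM2r// -mulrA ler_pM2l//.
have dlD : dl <= dl + A * h * decay q l.+1.
  by rewrite lerDl mulr_ge0 ?decay_ge0// mulr_ge0// ltW.
apply: (@le_trans _ _ (2 * lip_norm phi * (D * e * h))).
  apply: (@le_trans _ _ (2 * lip_norm phi * (dl + A * h * decay q l.+1))).
    rewrite /lip_norm [2 * (_ + _)]mulrDr addrC mulrDl lerD2l.
    apply: ler_pM => //; by rewrite mulr_natl mulr2n lerDl.
  by rewrite ler_wpM2l// mulr_ge0.
rewrite [leLHS](_ : _ = 2 * D * e * lip_norm phi * h); last by ring.
rewrite ler_wpM2r// ler_wpM2r// ler_wpM2r// /c4 lerDl mulr_ge0// powR_ge0.
Qed.
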